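(* Let $M$ be an $n$-manifold with a gerbe with connective structure, let $E$ be its generalized tangent bundle, and let $V\subset E$ be a generalized metric. Let $g$ be the associated Riemannian metric on $M$ and $H$ the curvature of the associated curving. For a vector field $X$ on $M$ let $X^+$ and $X^-$ be its lifts to sections of $V$ and $V^\perp$ respectively. Then for all vector fields $X,Y$, using the Courant bracket on sections of $E$, $$[X^-,Y^+]-[X,Y]^-=2g\nabla_XY\in\Omega^1(M),$$ where $\nabla$ is a connection on $T$ which preserves the metric $g$ and has skew torsion $-H$, meaning $$g\big(\nabla_XY-\nabla_YX-[X,Y]\big)=-\,i_Xi_YH .$$
   Context: $T$, $T^*$ are the tangent and cotangent bundles of $M$. $T\oplus T^*$ carries the inner product of signature $(n,n)$ with $(X+\xi,X+\xi)=i_X\xi$, so $(X+\xi,Y+\eta)=\frac12(i_X\eta+i_Y\xi)$. The Courant bracket on sections of $T\oplus T^*$ is $$[X+\xi,Y+\eta]=[X,Y]+\mathcal L_X\eta-\mathcal L_Y\xi-\tfrac12 d(i_X\eta-i_Y\xi).$$ It is invariant under $X+\xi\mapsto X+\xi+i_XB$ for closed $2$-forms $B$. A gerbe on $M$ is given, for an open covering $\{U_\alpha\}$, by a 2-cocycle $g_{\alpha\beta\gamma}:U_\alpha\cap U_\beta\cap U_\gamma\to S^1$. A connective structure is a collection of $1$-forms $A_{\alpha\beta}\in\Omega^1(U_\alpha\cap U_\beta)$ (with $A_{\beta\alpha}=-A_{\alpha\beta}$) such that $A_{\alpha\beta}+A_{\beta\gamma}+A_{\gamma\alpha}=g_{\alpha\beta\gamma}^{-1}dg_{\alpha\beta\gamma}$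 on triple intersections (Lie algebra of $S^1$ identified with $\mathbf R$). A curving is a collection $B_\alpha\in\Omega^2(U_\alpha)$ with $B_\beta-B_\alpha=dA_{\alpha\beta}$; its curvature is the global closed $3$-form $H$ with $H=dB_\alpha$ on $U_\alpha$. The generalized tangent bundle $E$ is the extension $0\to T^*\to E\xrightarrow{\pi}T\to0$ obtained by identifying $T\oplus T^*$ on $U_\alpha$ with $T\oplus T^*$ on $U_\beta$ by $X+\xi\mapsto X+\xi+i_XdA_{\alpha\beta}$; it inherits the inner product and a Courant bracket on its sections. A generalized metric is a rank $n$ subbundle $V\subset E$ on which the inner product is positive definite. Both $V$ and $V^\perp$ are complements of $T^*$ in $E$, so every vector field $X$ has unique lifts $X^+\in V$, $X^-\in V^\perp$ with $\pi(X^\pm)=X$. The associated metric $g$, also regarded as a map $g:T\to T^*$, is $gX=\frac12(X^+-X^-)$ (equivalently $g(X,Y)=(X^+,Y^+)$). The associated curving $\{B_\alpha\}$ is given by the averaged splitting: on $U_\alpha$, $\frac12(X^++X^-)=X+i_XB_\alpha$. In $i_Xi_YH$ one contracts first with $Y$ and then with $X$. *)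

(* Defs.v *)
From HB Require Import structures.
From mathcomp Require Import all_boot all_order all_algebra.
From mathcomp Require Import all_classical all_reals all_analysis.
From mathcomp Require Import complex.

Set Implicit Arguments.
Unset Strict Implicit.
Unset Printing Implicit Defensive.

Import Order.TTheory GRing.Theory Num.Theory numFieldNormedType.Exports.

Local Open Scope classical_set_scope.
Local Open Scope ring_scope.

(* Pointwise multilinear algebra on R^n: tangent vectors are rows, covectors  *)
(* are columns, a 2-form B is the matrix of the values B(e_j, e_k).           *)

Section Pointwise.
Context {R : realType} {n : nat}.

Definition basis_vec (j : 'I_n) : 'rV[R]_n := delta_mx 0 j.

Definition pairing (xi : 'cV[R]_n) (v : 'rV[R]_n) : R := (v *m xi) 0 0.

Definition eval2 (B : 'M[R]_n) (u v : 'rV[R]_n) : R :=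
  (u *m B *m v^T) 0 0.

(* i_u B, i.e. the covector v |-> B(u, v). *)
Definition contract2 (u : 'rV[R]_n) (B : 'M[R]_n) : 'cV[R]_n := (u *m B)^T.

End Pointwise.

(* Calculus in the model space R^n. *)

Section ModelCalculus.
Context {R : realType} {n : nat}.

Definition partials {W : normedModType R} (l : seq 'I_n)
    (f : 'rV[R]_n -> W) : 'rV[R]_n -> W :=
  foldr (fun j h => 'D_(basis_vec j) h) f l.

(* C^oo on an open set D: every iterated partial derivative (f included, for  *)
(* l = [::]) is differentiable at every point of D.                           *)
Definition smooth_on {W : normedModType R} (D : set 'rV[R]_n)
    (f : 'rV[R]_n -> W) : Prop :=
  forall (l : seq 'I_n) (x : 'rV[R]_n), D x -> differentiable (partials l f) x.

Implicit Types (X Y : 'rV[R]_n -> 'rV[R]_n) (w : 'rV[R]_n -> 'cV[R]_n).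

Definition grad (f : 'rV[R]_n -> R) (x : 'rV[R]_n) : 'cV[R]_n :=
  \col_j 'D_(basis_vec j) f x.

Definition lie_coord X Y (x : 'rV[R]_n) : 'rV[R]_n :=
  'D_(X x) Y x - 'D_(Y x) X x.

(* (L_X w)_j = X^i d_i w_j + w_i d_j X^i *)
Definition lie_deriv_coord X w (x : 'rV[R]_n) : 'cV[R]_n :=
  'D_(X x) w x + \col_j pairing (w x) ('D_(basis_vec j) X x).

(* (dw)(u, v) = D_u (w v) - D_v (w u) for constant u, v *)
Definition ext_deriv1_coord w (x : 'rV[R]_n) : 'M[R]_n :=
  \matrix_(j, k) (('D_(basis_vec j) w x) k 0 - ('D_(basis_vec k) w x) j 0).

(* (dB)(u, v, w) = D_u B(v, w) + D_v B(w, u) + D_w B(u, v) for constant u, v, w *)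
Definition ext_deriv2_coord (B : 'rV[R]_n -> 'M[R]_n) (x u v w : 'rV[R]_n) : R :=
  'D_u (fun y => eval2 (B y) v w) x
  + 'D_v (fun y => eval2 (B y) w u) x
  + 'D_w (fun y => eval2 (B y) u v) x.

(* [X + xi, Y + eta] = [X, Y] + L_X eta - L_Y xi - d(i_X eta - i_Y xi) / 2 *)
Definition courant_coord X (xi : 'rV[R]_n -> 'cV[R]_n) Y
    (eta : 'rV[R]_n -> 'cV[R]_n) (x : 'rV[R]_n) : 'rV[R]_n * 'cV[R]_n :=
  (lie_coord X Y x,
   lie_deriv_coord X eta x - lie_deriv_coord Y xi x
   - 2^-1 *: grad (fun y => pairing (eta y) (X y) - pairing (xi y) (Y y)) x).

End ModelCalculus.

(* Smooth manifolds without boundary.  The inverse chart `icoord i` is total, *)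
(* but only its restriction to the open set `coord i @` dom i` matters.  Each *)
(* point p comes with a preferred chart `chart_at p` around it, which serves  *)
(* to identify the tangent space at p with R^n.                               *)

Record smoothManifold (R : realType) (n : nat) := SmoothManifold {
  carrier :> topologicalType;
  carrier_hausdorff : hausdorff_space carrier;
  carrier_second_countable : @second_countable carrier;
  atlas : Type;
  dom : atlas -> set carrier;
  coord : atlas -> carrier -> 'rV[R]_n;
  icoord : atlas -> 'rV[R]_n -> carrier;
  dom_open : forall i, open (dom i);
  image_open : forall i, open (coord i @` dom i);
  coordK : forall i p, dom i p -> icoord i (coord i p) = p;
  coord_continuous : forall i p, dom i p -> {for p, continuous (coord i)};
  icoord_continuous : forall i x,
    (coord i @` dom i) x -> {for x, continuous (icoord i)};
  transition_smooth : forall i j,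
    smooth_on (coord i @` (dom i `&` dom j)) (coord j \o icoord i);
  chart_at : carrier -> atlas;
  mem_chart_at : forall p, dom (chart_at p) p }.

(* Tensor fields.  The tangent space at p is R^n, read in the chart           *)
(* `chart_at p`; so a vector field is a map M -> 'rV_n, a 1-form a map        *)
(* M -> 'cV_n and a 2-form a map M -> 'M_n.  Their components in an arbitrary *)
(* chart are obtained through the derivatives of the transition maps.         *)

Section Tensors.
Context {R : realType} {n : nat} {M : smoothManifold R n}.
Implicit Types (i : atlas M) (p : M) (U : set M).

Definition to_chart i p (v : 'rV[R]_n) : 'rV[R]_n :=
  'D_v (coord i \o icoord (chart_at p)) (coord (chart_at p) p).

Definition of_chart i p (v : 'rV[R]_n) : 'rV[R]_n :=
  'D_v (coord (chart_at p) \o icoord i) (coord i p).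

Definition vector_rep i (X : M -> 'rV[R]_n) (x : 'rV[R]_n) : 'rV[R]_n :=
  to_chart i (icoord i x) (X (icoord i x)).

Definition oneform_rep i (w : M -> 'cV[R]_n) (x : 'rV[R]_n) : 'cV[R]_n :=
  \col_j pairing (w (icoord i x)) (of_chart i (icoord i x) (basis_vec j)).

Definition twoform_rep i (B : M -> 'M[R]_n) (x : 'rV[R]_n) : 'M[R]_n :=
  \matrix_(j, k) eval2 (B (icoord i x))
    (of_chart i (icoord i x) (basis_vec j))
    (of_chart i (icoord i x) (basis_vec k)).

(* Smoothness on an open subset U of M; values outside U are irrelevant. *)
Definition smooth_fun U (f : M -> R) : Prop :=
  forall i, smooth_on (coord i @` (dom i `&` U)) (f \o icoord i).

Definition smooth_vector U (X : M -> 'rV[R]_n) : Prop :=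
  forall i, smooth_on (coord i @` (dom i `&` U)) (vector_rep i X).

Definition smooth_oneform U (w : M -> 'cV[R]_n) : Prop :=
  forall i, smooth_on (coord i @` (dom i `&` U)) (oneform_rep i w).

(* v f, for a tangent vector v at p *)
Definition dir_deriv (f : M -> R) p (v : 'rV[R]_n) : R :=
  'D_v (f \o icoord (chart_at p)) (coord (chart_at p) p).

Definition lie_bracket (X Y : M -> 'rV[R]_n) p : 'rV[R]_n :=
  lie_coord (vector_rep (chart_at p) X) (vector_rep (chart_at p) Y)
    (coord (chart_at p) p).

Definition ext_deriv1 (w : M -> 'cV[R]_n) p : 'M[R]_n :=
  ext_deriv1_coord (oneform_rep (chart_at p) w) (coord (chart_at p) p).

Definition ext_deriv2 (B : M -> 'M[R]_n) p (u v w : 'rV[R]_n) : R :=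
  ext_deriv2_coord (twoform_rep (chart_at p) B) (coord (chart_at p) p) u v w.

End Tensors.

(* Gerbes with connective structure.  Each point p comes with a preferred     *)
(* member `index_at p` of the covering that contains it.                      *)

Record gerbe (R : realType) (n : nat) (M : smoothManifold R n) := Gerbe {
  gindex : Type;
  cover : gindex -> set M;
  cover_open : forall a, open (cover a);
  index_at : M -> gindex;
  mem_index_at : forall p, cover (index_at p) p;
  cocycle : gindex -> gindex -> gindex -> M -> R[i];
  cocycle_circle : forall a b c p, cover a p -> cover b p -> cover c p ->
    `|cocycle a b c p| = 1;
  cocycle_smooth : forall a b c,
    smooth_fun (cover a `&` cover b `&` cover c)
      (fun p => complex.Re (cocycle a b c p)) /\
    smooth_fun (cover a `&` cover b `&` cover c)
      (fun p => complex.Im (cocycle a b c p));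
  cocycle_closed : forall a b c d p,
    cover a p -> cover b p -> cover c p -> cover d p ->
    cocycle b c d p * (cocycle a c d p)^-1
      * cocycle a b d p * (cocycle a b c p)^-1 = 1 }.

(* The tangent line of S^1 at 1 is iR; t : R stands for the element i t. *)
Record connectiveStructure (R : realType) (n : nat) (M : smoothManifold R n)
    (G : gerbe M) := ConnectiveStructure {
  conn_form :> gindex G -> gindex G -> M -> 'cV[R]_n;
  conn_smooth : forall a b,
    smooth_oneform (cover a `&` cover b) (conn_form a b);
  conn_skew : forall a b p, cover a p -> cover b p ->
    conn_form b a p = - conn_form a b p;
  conn_cocycle : forall a b c p (v : 'rV[R]_n),
    cover a p -> cover b p -> cover c p ->
    'i%C * (pairing (conn_form a b p + conn_form b c p + conn_form c a p) v)%:C%C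
    = (cocycle a b c p)^-1 *
      ((dir_deriv (fun q => complex.Re (cocycle a b c q)) p v)%:C%C
       + 'i%C * (dir_deriv (fun q => complex.Im (cocycle a b c q)) p v)%:C%C) }.

(* The generalized tangent bundle E.  Its fibre at p is T_p + T_p^*, read in  *)
(* the trivialization of E over the open set `cover (index_at p)`; on fibres  *)
(* at p, T^* is therefore the subspace {0} x 'cV_n and pi is fst.             *)

Notation gtFiber R n := ('rV[R]_n * 'cV[R]_n)%type.

Section GeneralizedTangent.
Context {R : realType} {n : nat} {M : smoothManifold R n} {G : gerbe M}.
Variable A : connectiveStructure G.
Implicit Types (a : gindex G) (p : M) (s t : M -> gtFiber R n).

Definition inner (e f : gtFiber R n) : R :=
  2^-1 * (pairing f.2 e.1 + pairing e.2 f.1).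

(* The element of T + T^* over `cover a` which represents e : E_p. *)
Definition gt_triv a p (e : gtFiber R n) : gtFiber R n :=
  (e.1, e.2 + contract2 e.1 (ext_deriv1 (A (index_at G p) a) p)).

Definition gt_smooth (W : set M) s : Prop :=
  smooth_vector W (fun p => (s p).1) /\
  forall a, smooth_oneform (W `&` cover a) (fun p => (gt_triv a p (s p)).2).

(* Computed around p in the trivialization over `cover (index_at p)`. *)
Definition gt_courant s t p : gtFiber R n :=
  let i := chart_at p in
  let a := index_at G p in
  courant_coord
    (vector_rep i (fun q => (s q).1))
    (oneform_rep i (fun q => (gt_triv a q (s q)).2))
    (vector_rep i (fun q => (t q).1))
    (oneform_rep i (fun q => (gt_triv a q (t q)).2))
    (coord i p).

Definition generalized_metric (V : M -> {vspace gtFiber R n}) : Prop :=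
  [/\ forall p, \dim (V p) = n,
      forall p, exists (W : set M) (s : 'I_n -> M -> gtFiber R n),
        [/\ open W, W p, forall k, gt_smooth W (s k) &
            forall q, W q -> V q = <<[seq s k q | k : 'I_n]>>%VS] &
      forall p (e : gtFiber R n), e \in V p -> e != 0 -> 0 < inner e e].

Variable V : M -> {vspace gtFiber R n}.

(* The lifts of v : T_p to V_p and to its orthogonal complement. *)
Definition lift_plus p (v : 'rV[R]_n) : gtFiber R n :=
  xget 0 [set e | e \in V p /\ e.1 = v].

Definition lift_minus p (v : 'rV[R]_n) : gtFiber R n :=
  xget 0 [set e | (forall f, f \in V p -> inner e f = 0) /\ e.1 = v].

(* g : T -> T^*; the T-component of (v^+ - v^-) / 2 vanishes. *)
Definition metric_map p (v : 'rV[R]_n) : 'cV[R]_n :=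
  (2^-1 *: (lift_plus p v - lift_minus p v)).2.

Definition metric p (u v : 'rV[R]_n) : R := pairing (metric_map p u) v.

(* B_a, determined by (v^+ + v^-) / 2 = v + i_v B_a over `cover a`: row j is  *)
(* i_v B_a for v the j-th basis vector.                                       *)
Definition curving a p : 'M[R]_n :=
  \matrix_(j, k)
    (gt_triv a p (2^-1 *: (lift_plus p (basis_vec j)
                           + lift_minus p (basis_vec j)))).2 k 0.

(* H = dB_a on `cover a`; at p this is evaluated with a := index_at p. *)
Definition curvature p (u v w : 'rV[R]_n) : R :=
  ext_deriv2 (curving (index_at G p)) p u v w.

End GeneralizedTangent.

Section Connections.
Context {R : realType} {n : nat} {M : smoothManifold R n}.
Implicit Types (X Y Z : M -> 'rV[R]_n) (f : M -> R).
Implicit Types (nabla : (M -> 'rV[R]_n) -> (M -> 'rV[R]_n) -> M -> 'rV[R]_n).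

Local Notation vfield X := (smooth_vector setT X).

Definition is_connection nabla : Prop :=
  (forall X Y, vfield X -> vfield Y -> vfield (nabla X Y)) /\
  (forall X X' Y, vfield X -> vfield X' -> vfield Y ->
     forall p, nabla (fun q => X q + X' q) Y p = nabla X Y p + nabla X' Y p) /\
  (forall f X Y, smooth_fun setT f -> vfield X -> vfield Y ->
     forall p, nabla (fun q => f q *: X q) Y p = f p *: nabla X Y p) /\
  (forall X Y Y', vfield X -> vfield Y -> vfield Y' ->
     forall p, nabla X (fun q => Y q + Y' q) p = nabla X Y p + nabla X Y' p) /\
  (forall f X Y, smooth_fun setT f -> vfield X -> vfield Y ->
     forall p, nabla X (fun q => f q *: Y q) p =
               dir_deriv f p (X p) *: Y p + f p *: nabla X Y p).

Definition preserves_metric (g : M -> 'rV[R]_n -> 'rV[R]_n -> R) nabla : Prop :=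
  forall X Y Z, vfield X -> vfield Y -> vfield Z ->
  forall p, dir_deriv (fun q => g q (Y q) (Z q)) p (X p) =
            g p (nabla X Y p) (Z p) + g p (Y p) (nabla X Z p).

(* g(nabla_X Y - nabla_Y X - [X, Y]) = - i_X i_Y H, where                     *)
(* i_X i_Y H = H(Y, X, _).                                                    *)
Definition has_skew_torsion_opp (g : M -> 'rV[R]_n -> 'rV[R]_n -> R)
    (H : M -> 'rV[R]_n -> 'rV[R]_n -> 'rV[R]_n -> R) nabla : Prop :=
  forall X Y, vfield X -> vfield Y ->
  forall p (w : 'rV[R]_n),
    g p (nabla X Y p - nabla Y X p - lie_bracket X Y p) w = - H p (Y p) (X p) w.

End Connections.

(* Main.v *)
(** The subbundle V is the graph of a field C of bilinear forms on T, with
    C(v, w) = C_jk v^j w^k, and its orthogonal complement is the graph of - C^T;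
    so g is the symmetric part of C and the curving its antisymmetric part.  In a
    chart and a trivialization of E, expanding [X^-, Y^+] - [X, Y]^- gives the
    one-form
      2 g_jk (D_X Y)^j + X^i Y^j (d_i C_jk + d_j C_ki - d_k C_ji),
    and reading off Christoffel symbols from it defines the connection.  The
    symmetric part of (d_i C_jk + d_j C_ki - d_k C_ji) in j, k is d_i g_jk, whence
    metric compatibility; its antisymmetric part in i, j is dB, whence the
    torsion.  The one-form depends neither on the chart nor on the trivialization,
    because second derivatives commute and the two-forms dA_ab are closed.  Since
    C is smooth, as one sees on local frames of V, so is the connection. *)

From HB Require Import structures.
From mathcomp Require Import all_boot all_order all_algebra.
From mathcomp Require Import all_classical all_reals all_analysis.
From mathcomp Require Import complex ring lra.
Require Import Defs.

Set Implicit Arguments.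
Unset Strict Implicit.
Unset Printing Implicit Defensive.

Import Order.TTheory GRing.Theory Num.Theory numFieldNormedType.Exports.

Local Open Scope classical_set_scope.
Local Open Scope ring_scope.

(** * Derivatives of matrix-valued functions *)

Section MatrixCalculus.
Context {R : realType} {V : normedModType R}.

(** Tensor fields, exterior derivatives and the Courant bracket are evaluated at p in the preferred
    chart and covering index of p, and these choices need not vary continuously with p. A field
    given pointwise therefore cannot be differentiated as it stands: each object is identified with
    its components in one fixed chart and one fixed index near the point. The invariance statements
    [koszul_change] and [koszul_addl_closed] are what makes the pointwise definition of the
    connection smooth.

    The gerbe enters through one fact: the gluing two-forms dA_ab add up to zero on triple
    intersections. The sum of the connection forms is g^-1 dg for a circle-valued g, and it is shown
    to be closed through the real and imaginary parts of g, without choosing a logarithm.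

    Invariance under charts comes down to the symmetry of Hessians. Since smoothness means iterated
    differentiability, symmetry of second derivatives is proved from differentiability of the first
    derivatives at the point. *)

Lemma derive_linear (W : normedModType R) (f : V -> W) x a u v :
  differentiable f x -> 'D_(a *: u + v) f x = a *: 'D_u f x + 'D_v f x.
Proof. by move=> df; rewrite !deriveE// linearP. Qed.

Lemma derive_addv (W : normedModType R) (f : V -> W) x u v :
  differentiable f x -> 'D_(u + v) f x = 'D_u f x + 'D_v f x.
Proof. by move=> df; rewrite !deriveE// linearD. Qed.

Lemma derive_scalev (W : normedModType R) (f : V -> W) x a u :
  differentiable f x -> 'D_(a *: u) f x = a *: 'D_u f x.
Proof. by move=> df; rewrite !deriveE// linearZ. Qed.

Lemma derive_chain (U W : normedModType R) (f : V -> U) (g : U -> W) x v :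
  differentiable f x -> differentiable g (f x) ->
  'D_v (g \o f) x = 'D_('D_v f x) g (f x).
Proof.
move=> df dg; rewrite (deriveE _ (differentiable_comp df dg)).
by rewrite (diff_comp df dg) (deriveE _ df) (deriveE _ dg).
Qed.

(** Differentiability of [g] refers to its own differential, so it is shown that ['d f x] satisfies
    the first-order expansion of [g]; uniqueness of that expansion then identifies the two
    differentials. *)
Lemma near_eq_differentiable (W : normedModType R) (f g : V -> W) x :
  (\near x, f x = g x) -> differentiable f x -> differentiable g x.
Proof.
move=> fg df; have fgx : f x = g x := nbhs_singleton fg.
have gE : g \o shift x = cst (g x) + 'd f x +o_ 0 id.
  apply/eqaddoP => _/posnumP[e].
  have /eqaddoP/(_ e%:num)/(_ [gt0 of e%:num]) := diff_locally df.
  rewrite (near_shift 0) subr0 in fg; apply: filterS2 fg => h /= fgh.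
  by rewrite !fctE /= fgh fgx.
have dfc : continuous ('d f x) by exact: diff_continuous.
by apply/diff_locallyP; rewrite (diff_unique dfc gE).
Qed.

Lemma differentiable_mxP m n (f : V -> 'M[R]_(m, n)) x :
  differentiable f x <-> forall i j, differentiable (fun y => f y i j) x.
Proof.
split=> [df i j|df].
  have -> : (fun y => f y i j) = (fun A : 'M[R]_(m, n) => A i j) \o f by [].
  by apply: differentiable_comp => //; exact: differentiable_coord.
have -> : f = \sum_(i < m) \sum_(j < n) (fun y => f y i j *: delta_mx i j).
  apply/funext => y; rewrite [LHS]matrix_sum_delta fct_sumE.
  by apply: eq_bigr => i _; rewrite fct_sumE.
apply: differentiable_sum => i; apply: differentiable_sum => j.
exact: differentiableZl.
Qed.

Lemma derive_mxE m n (f : V -> 'M[R]_(m, n)) x v i j :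
  differentiable f x -> ('D_v f x) i j = 'D_v (fun y => f y i j) x.
Proof. by move=> df; rewrite derive_mx ?mxE//; exact: diff_derivable. Qed.

Lemma differentiable_mulmx m n p (f : V -> 'M[R]_(m, n)) (g : V -> 'M[R]_(n, p)) x :
  differentiable f x -> differentiable g x ->
  differentiable (fun y => f y *m g y) x.
Proof.
move=> /differentiable_mxP df /differentiable_mxP dg.
apply/differentiable_mxP => i j.
have -> : (fun y => (f y *m g y) i j) =
    \sum_(k < n) ((fun y => f y i k) * (fun y => g y k j)).
  by apply/funext => y; rewrite mxE fct_sumE.
by apply: differentiable_sum => k; exact: differentiableM.
Qed.

Lemma derive_mulmx m n p (f : V -> 'M[R]_(m, n)) (g : V -> 'M[R]_(n, p)) x v :
  differentiable f x -> differentiable g x ->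
  'D_v (fun y => f y *m g y) x = 'D_v f x *m g x + f x *m 'D_v g x.
Proof.
move=> df dg; have /differentiable_mxP df' := df.
have /differentiable_mxP dg' := dg.
apply/matrixP => i j; rewrite derive_mxE; last exact: differentiable_mulmx.
have -> : (fun y => (f y *m g y) i j) =
    \sum_(k < n) ((fun y => f y i k) * (fun y => g y k j)).
  by apply/funext => y; rewrite mxE fct_sumE.
rewrite derive_sum; last first.
  by move=> k; apply: diff_derivable; exact: differentiableM.
rewrite !mxE -big_split/=; apply: eq_bigr => k _.
rewrite deriveM; [|exact: diff_derivable..].
rewrite (derive_mxE _ _ _ df) (derive_mxE _ _ _ dg) addrC; congr (_ + _).
exact: mulrC.
Qed.

Lemma differentiable_trmx m n (f : V -> 'M[R]_(m, n)) x :
  differentiable f x -> differentiable (fun y => (f y)^T) x.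
Proof.
move=> /differentiable_mxP df; apply/differentiable_mxP => i j.
by under [X in differentiable X _]eq_fun do rewrite mxE; exact: df.
Qed.

Lemma derive_trmx m n (f : V -> 'M[R]_(m, n)) x v :
  differentiable f x -> 'D_v (fun y => (f y)^T) x = ('D_v f x)^T.
Proof.
move=> df; apply/matrixP => i j.
rewrite mxE !derive_mxE//; last exact: differentiable_trmx.
by under eq_fun do rewrite mxE.
Qed.

End MatrixCalculus.

(** * Symmetry of second derivatives *)

Section Schwarz.
Context {R : realType} {V : normedModType R}.

Lemma differentiable_approx (f : V -> R) x : differentiable f x ->
  forall e, 0 < e -> \forall z \near (0 : V),
    `|f (x + z) - f x - 'D_z f x| <= e * `|z|.
Proof.
move=> df e e0.
have /eqaddoP/(_ e)/(_ e0) := diff_locally df.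
apply: filterS => h /=.
by rewrite !fctE /= -deriveE// opprD addrA [h + x]addrC.
Qed.

Lemma differentiable_scalel (u : V) (s : R) : differentiable (fun r : R => r *: u) s.
Proof. exact: (@differentiableZl R R^o V id u s). Qed.

Lemma differentiable_line (x u w : V) (s : R) :
  differentiable (fun s : R => x + (s *: u + w)) s.
Proof.
apply: differentiableD; first exact: differentiable_cst.
apply: differentiableD; last exact: differentiable_cst.
exact: differentiable_scalel.
Qed.

Lemma derive_line (x u w : V) (s : R) :
  'D_1 (fun s : R => x + (s *: u + w)) s = u.
Proof.
have d1 : derivable (fun r : R => r *: u) s 1.
  by apply: diff_derivable; exact: differentiable_scalel.
have d2 : derivable ((fun s : R => s *: u) + cst w) s 1.
  by apply: derivableD => //; exact: derivable_cst.
rewrite [LHS](deriveD (derivable_cst x s 1) d2) derive_cst add0r.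
rewrite (deriveD d1 (derivable_cst w s 1)) derive_cst addr0.
rewrite (deriveE _ (differentiable_scalel u s)) (@diffZl R R^o V id)//.
by rewrite -deriveE// derive_id scale1r.
Qed.

(** The mean value theorem in direction [u], applied to the increment [F] of [f] along [h *: v],
    turns the second difference into h times an increment of ['D_u f]. Differentiability of ['D_u f]
    at the single point [x] estimates that increment. *)
Lemma second_difference (f : V -> R) x u v :
  (\near x, differentiable f x) -> differentiable ('D_u f) x ->
  forall e, 0 < e -> \forall h \near 0^'+,
    `|f (x + h *: u + h *: v) - f (x + h *: u) - f (x + h *: v) + f x
      - h ^+ 2 * 'D_v ('D_u f) x| <= e * h ^+ 2.
Proof.
(* The two remainders add up to at most e / K times |c u + h v| + |c u|, hence to e / K times h (2
   |u| + |v|); the added 1 keeps [K] positive. *)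
move=> nf dG e e0; set K := 2 * `|u| + `|v| + 1.
have K0 : 0 < K by rewrite /K ltr_wpDl// addr_ge0// mulr_ge0.
have /nbhs_norm0P[d /= d0 hd] := differentiable_approx dG (divr_gt0 e0 K0).
have /nbhs_normP[d' /= d'0 hd'] := nf.
near=> h.
have h0 : 0 < h by near: h; exact: nbhs_right_gt.
have hK : h * K < d.
  rewrite -ltr_pdivlMr//; near: h; apply: nbhs_right_lt; exact: divr_gt0.
have hK' : h * K < d'.
  rewrite -ltr_pdivlMr//; near: h; apply: nbhs_right_lt; exact: divr_gt0.
have bnd (s t : R) : 0 <= s <= h -> 0 <= t <= h ->
    `|s *: u + t *: v| <= h * (`|u| + `|v|).
  move=> /andP[s0 sh] /andP[t0 th]; rewrite (le_trans (ler_normD _ _))//.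
  by rewrite !normrZ !ger0_norm// mulrDr lerD// ler_wpM2r.
have bndK (s t : R) : 0 <= s <= h -> 0 <= t <= h ->
    `|s *: u + t *: v| < h * K.
  move=> hs ht; apply: le_lt_trans (bnd _ _ hs ht) _.
  by rewrite ltr_pM2l// /K mulr_natl mulr2n -!addrA ltrD2l ltr_wpDl// ltrDl.
pose F s := f (x + (s *: u + h *: v)) - f (x + (s *: u + 0 *: v)).
pose dF s := 'D_u f (x + (s *: u + h *: v)) - 'D_u f (x + (s *: u + 0 *: v)).
have dline (s t : R) : 0 <= s <= h -> 0 <= t <= h ->
    is_derive s 1 (fun s => f (x + (s *: u + t *: v))) ('D_u f (x + (s *: u + t *: v))).
  move=> hs ht.
  have dfy : differentiable f (x + (s *: u + t *: v)).
    by apply: hd'; rewrite /ball_ /= opprD addNKr normrN (lt_trans (bndK _ _ hs ht)).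
  have dl : differentiable (fun s : R => x + (s *: u + t *: v)) s.
    exact: differentiable_line.
  apply: DeriveDef.
    by apply: diff_derivable; exact: (differentiable_comp dl dfy).
  by rewrite (derive_chain _ dl dfy) derive_line.
have hF s : 0 <= s <= h -> is_derive s 1 F (dF s).
  move=> hs; apply: is_deriveB; apply: dline => //; rewrite ?lexx ?ltW//.
have [c /[!in_itv]/= /andP[c0 ch] FE] : exists2 c, c \in `]0, h[%R &
    F h - F 0 = dF c * (h - 0).
  apply: MVT => //.
    by move=> s /[!in_itv]/= /andP[s0 sh]; apply: hF; rewrite !ltW.
  apply: derivable_within_continuous => s /[!in_itv]/= hs.
  by have := hF _ hs => -[].
have cI : 0 <= c <= h by rewrite !ltW.
have hI : 0 <= h <= h by rewrite lexx ltW.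
have zI : 0 <= (0:R) <= h by rewrite lexx ltW.
have b1 := hd _ (lt_trans (bndK _ _ cI hI) hK).
have b2 := hd _ (lt_trans (bndK _ _ cI zI) hK).
rewrite /= in b1 b2.
have -> : f (x + h *: u + h *: v) - f (x + h *: u) - f (x + h *: v) + f x =
    F h - F 0 by rewrite /F !scale0r !addr0 !add0r !addrA opprB addrA addrAC.
rewrite FE subr0.
(* Both values of ['D_u f] are compared with its linear approximation at [x]; the two approximations
   differ by exactly h D_v D_u f. *)
have -> : dF c * h - h ^+ 2 * 'D_v ('D_u f) x =
   h * (('D_u f (x + (c *: u + h *: v)) - 'D_u f x - 'D_(c *: u + h *: v) ('D_u f) x) -
        ('D_u f (x + (c *: u + 0 *: v)) - 'D_u f x - 'D_(c *: u + 0 *: v) ('D_u f) x)).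
  rewrite !derive_addv// !derive_scalev// /dF.
  have dfE (a b c' d1 d2 k : R) : (a - b) * k - k ^+ 2 * d2 =
    k * (a - c' - (d1 + k *: d2) - (b - c' - (d1 + 0 *: d2))).
    by rewrite /GRing.scale/=; ring.
  exact: dfE.
rewrite normrM gtr0_norm// expr2 mulrCA ler_pM2l//.
apply: (le_trans (ler_normB _ _)); apply: (le_trans (lerD b1 b2)).
rewrite -mulrDr -mulrA ler_pM2l// mulrC ler_pdivrMr//.
apply: (@le_trans _ _ (h * (`|u| + `|v|) + h * `|u|)).
  apply: lerD; first exact: bnd.
  rewrite scale0r addr0 normrZ (ger0_norm (ltW c0)).
  by apply: ler_wpM2r => //; exact: ltW.
rewrite -mulrDr ler_pM2l// /K mulr_natl mulr2n.
by rewrite addrAC lerDl.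
Unshelve. all: by end_near. Qed.

(** The second difference is symmetric in [u] and [v], so both iterated derivatives, multiplied by
    h^2, lie within e h^2 / 2 of the same number. *)
Lemma derive_comm (f : V -> R) x u v :
  (\near x, differentiable f x) -> differentiable ('D_u f) x ->
  differentiable ('D_v f) x -> 'D_v ('D_u f) x = 'D_u ('D_v f) x.
Proof.
move=> nf du dv; apply/eqP; rewrite -subr_eq0 -normr_le0.
apply/ler_addgt0Pr => e e0; rewrite add0r.
have e20 : 0 < e / 2 by rewrite divr_gt0.
have [h [h0 [b1 b2]]] := filter_ex (filterI (nbhs_right_gt (0:R))
  (filterI (second_difference v nf du e20) (second_difference u nf dv e20))).
rewrite [x + h *: v + h *: u]addrAC [_ - f (x + h *: v) - _]addrAC in b2.
have h20 : 0 < h ^+ 2 by rewrite exprn_gt0.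
rewrite -(ler_pM2l h20) -[X in X * `|_|]gtr0_norm// -normrM.
move: (f _ - _ - _ + _) b1 b2 => a b1 b2.
rewrite mulrBr; apply: (le_trans (ler_distD a _ _)).
rewrite [X in X + _]distrC; apply: (le_trans (lerD b1 b2)).
by rewrite -mulrDl -splitr mulrC.
Qed.

End Schwarz.

(** * Iterated differentiability *)

Section Smooth.
Context {R : realType} {n : nat}.
Local Notation E := 'rV[R]_n.

Lemma near_open (T : topologicalType) (D : set T) x :
  open D -> D x -> \near x, D x.
Proof. by move=> oD Dx; exact: open_nbhs_nbhs. Qed.

Lemma derive_pairing (f : E -> R) x v :
  differentiable f x -> 'D_v f x = pairing (grad f x) v.
Proof.
move=> df; rewrite {1}[v]row_sum_delta deriveE// linear_sum /pairing mxE.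
by apply: eq_bigr => j _; rewrite linearZ !mxE -deriveE.
Qed.

(* Partial derivatives up to order k are differentiable on D, so that ck k    *)
(* lies between C^k and C^(k+1).                                              *)
Fixpoint ck {W : normedModType R} (k : nat) (D : set E) (f : E -> W) : Prop :=
  (forall x, D x -> differentiable f x) /\
  if k is k'.+1 then forall j, ck k' D ('D_(basis_vec j) f) else True.

Lemma ck_diff {W : normedModType R} k D (f : E -> W) x :
  ck k D f -> D x -> differentiable f x.
Proof. by case: k => [|k] [df _]; exact: df. Qed.

Lemma ckS {W : normedModType R} k D (f : E -> W) : ck k.+1 D f -> ck k D f.
Proof.
elim: k f => [|k IHk] f [df ckf]; split=> // j.
exact/IHk/ckf.
Qed.

Lemma smooth_on_derive {W : normedModType R} D (f : E -> W) j :
  smooth_on D f -> smooth_on D ('D_(basis_vec j) f).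
Proof.
by move=> sf l x Dx; have := sf (rcons l j) x Dx; rewrite /partials foldr_rcons.
Qed.

Lemma smooth_on_ck {W : normedModType R} D (f : E -> W) :
  smooth_on D f <-> forall k, ck k D f.
Proof.
split=> [sf k|ckf l].
  elim: k f sf => [|k IHk] f sf; split=> //; try exact: (sf [::]).
  by move=> j; exact/IHk/smooth_on_derive.
(* [partials] applies the last index of [l] innermost, and [ck] peels off the innermost derivative;
   hence the induction from the right end. *)
move: (ckf (size l)) => {ckf}; elim/last_ind: l f => [|l j IHl] f.
  by move=> [df _].
rewrite size_rcons => -[_ ckf] x Dx.
by rewrite /partials foldr_rcons; exact: (IHl _ (ckf j)).
Qed.

Lemma ck_sub {W : normedModType R} k D D' (f : E -> W) :
  D' `<=` D -> ck k D f -> ck k D' f.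
Proof.
move=> DD'; elim: k f => [|k IHk] f [df ckf]; split=> //.
- by move=> x /DD'; exact: df.
- by move=> x /DD'; exact: df.
- by move=> j; exact/IHk/ckf.
Qed.

Lemma ck_ext {W : normedModType R} k D (f g : E -> W) : open D ->
  (forall x, D x -> f x = g x) -> ck k D f -> ck k D g.
Proof.
move=> oD; elim: k f g => [|k IHk] f g fg [df ckf].
  split=> // x Dx; apply: near_eq_differentiable (df _ Dx).
  by apply: filterS (near_open oD Dx) => y; exact: fg.
split=> [x Dx|j].
  apply: near_eq_differentiable (df _ Dx).
  by apply: filterS (near_open oD Dx) => y; exact: fg.
apply: IHk (ckf j) => x Dx; apply: near_eq_derive.
by apply: filterS (near_open oD Dx) => y; exact: fg.
Qed.

(** Serves where the available neighbourhood depends on the point, as with local frames of V and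
    members of the covering. *)
Lemma ck_local {W : normedModType R} m D (f : E -> W) :
  (forall x, D x -> exists2 D', D' x & ck m D' f) -> ck m D f.
Proof.
elim: m f => [|m IHm] f loc.
  by split=> // x /loc[D' D'x cf]; exact: ck_diff cf D'x.
split=> [x /loc[D' D'x cf]|j]; first exact: ck_diff cf D'x.
by apply: IHm => x /loc[D' D'x [_ cf]]; exists D' => //; exact: cf.
Qed.

Lemma ck_cst {W : normedModType R} k D (c : W) : ck k D (fun=> c : W).
Proof.
elim: k c => [|k IHk] c; first by split=> // x _; exact: differentiable_cst.
split=> [x _|j]; first exact: differentiable_cst.
suff -> : 'D_(basis_vec j) (fun=> c) = (fun=> 0) by [].
by apply/funext => x; exact: derive_cst.
Qed.

Lemma ckD {W : normedModType R} k D (f g : E -> W) : open D ->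
  ck k D f -> ck k D g -> ck k D (fun x => f x + g x).
Proof.
move=> oD; elim: k f g => [|k IHk] f g [df ckf] [dg ckg].
  by split=> // x Dx; apply: differentiableD; [exact: df|exact: dg].
split=> [x Dx|j]; first by apply: differentiableD; [exact: df|exact: dg].
apply: ck_ext (IHk _ _ (ckf j) (ckg j)) => // x Dx.
by rewrite -deriveD//; apply: diff_derivable; [exact: df|exact: dg].
Qed.

Lemma ckN {W : normedModType R} k D (f : E -> W) : open D ->
  ck k D f -> ck k D (fun x => - f x).
Proof.
move=> oD; elim: k f => [|k IHk] f [df ckf].
  by split=> // x Dx; apply: differentiableN; exact: df.
split=> [x Dx|j]; first by apply: differentiableN; exact: df.
apply: ck_ext (IHk _ (ckf j)) => // x Dx.
by rewrite -deriveN//; apply: diff_derivable; exact: df.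
Qed.

Lemma ck_mulmx m p q k D (f : E -> 'M[R]_(m, p)) (g : E -> 'M[R]_(p, q)) :
  open D -> ck k D f -> ck k D g -> ck k D (fun x => f x *m g x).
Proof.
move=> oD; elim: k f g => [|k IHk] f g.
  move=> [df ckf] [dg ckg]; split=> // x Dx.
  by apply: differentiable_mulmx; [exact: df|exact: dg].
move=> ckf ckg; have [df ckf'] := ckf; have [dg ckg'] := ckg.
split=> [x Dx|j]; first by apply: differentiable_mulmx; [exact: df|exact: dg].
have := ckD oD (IHk _ _ (ckf' j) (ckS ckg)) (IHk _ _ (ckS ckf) (ckg' j)).
apply: ck_ext => // x Dx.
by rewrite derive_mulmx//; [exact: df|exact: dg].
Qed.

Lemma ck_entry m p k D (f : E -> 'M[R]_(m, p)) i j : open D ->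
  ck k D f -> ck k D (fun x => f x i j).
Proof.
move=> oD; elim: k f => [|k IHk] f [df ckf].
  by split=> // x Dx; have /differentiable_mxP := df _ Dx; exact.
split=> [x Dx|l]; first by have /differentiable_mxP := df _ Dx; exact.
apply: ck_ext (IHk _ (ckf l)) => // x Dx.
by rewrite derive_mxE//; exact: df.
Qed.

Lemma ck_mx m p k D (f : E -> 'M[R]_(m, p)) : open D ->
  (forall i j, ck k D (fun x => f x i j)) -> ck k D f.
Proof.
move=> oD; elim: k f => [|k IHk] f ckf.
  by split=> // x Dx; apply/differentiable_mxP => i j; have [+ _] := ckf i j; exact.
have df x : D x -> differentiable f x.
  by move=> Dx; apply/differentiable_mxP => i j; have [+ _] := ckf i j; exact.
split=> // l; apply: IHk => i j; have [_ /(_ l)] := ckf i j.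
apply: ck_ext => // x Dx.
by rewrite derive_mxE//; exact: df.
Qed.

Lemma ck_trmx m p k D (f : E -> 'M[R]_(m, p)) : open D ->
  ck k D f -> ck k D (fun x => (f x)^T).
Proof.
move=> oD ckf; apply: ck_mx => // i j.
by apply: ck_ext (ck_entry j i oD ckf) => // x _; rewrite mxE.
Qed.

(** * Determinants and inverses of matrix-valued functions *)

Lemma differentiable_prod (I : Type) (r : seq I) (P : pred I) (f : I -> E -> R) x :
  (forall i, differentiable (f i) x) ->
  differentiable (fun y => \prod_(i <- r | P i) f i y) x.
Proof.
move=> df; elim: r => [|i r IHr].
  by under [X in differentiable X _]eq_fun do rewrite big_nil; exact: differentiable_cst.
under [X in differentiable X _]eq_fun do rewrite big_cons.
by case: (P i) => //; exact: differentiableM.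
Qed.

Lemma differentiable_bigsum (I : Type) (r : seq I) (P : pred I) (f : I -> E -> R) x :
  (forall i, differentiable (f i) x) ->
  differentiable (fun y => \sum_(i <- r | P i) f i y) x.
Proof.
move=> df; elim: r => [|i r IHr].
  by under [X in differentiable X _]eq_fun do rewrite big_nil; exact: differentiable_cst.
under [X in differentiable X _]eq_fun do rewrite big_cons.
by case: (P i) => //; exact: differentiableD.
Qed.

Lemma differentiable_det m (f : E -> 'M[R]_m) x :
  differentiable f x -> differentiable (fun y => \det (f y)) x.
Proof.
move=> /differentiable_mxP df; rewrite /determinant.
apply: differentiable_bigsum => s.
apply: differentiableM; first exact: differentiable_cst.
by apply: differentiable_prod => i; exact: df.
Qed.

Lemma differentiable_invmx m (f : E -> 'M[R]_m) x : differentiable f x ->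
  (\near x, f x \in unitmx) -> differentiable (fun y => invmx (f y)) x.
Proof.
move=> df nu.
have dadj : differentiable (fun y => \adj (f y)) x.
  apply/differentiable_mxP => i j.
  under [X in differentiable X _]eq_fun do rewrite mxE.
  apply: differentiableM; first exact: differentiable_cst.
  apply: differentiable_det; apply/differentiable_mxP => k l.
  under [X in differentiable X _]eq_fun do rewrite !mxE.
  by have /differentiable_mxP := df; exact.
apply: (@near_eq_differentiable _ _ _ (fun y => (\det (f y))^-1 *: \adj (f y))).
  by apply: filterS nu => y fy; rewrite /invmx fy.
apply/differentiable_mxP => i j.
under [X in differentiable X _]eq_fun do rewrite mxE.
apply: differentiableM; last by have /differentiable_mxP := dadj; exact.
apply: differentiableV; first exact: differentiable_det.
by have := nbhs_singleton nu; rewrite unitmxE unitfE.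
Qed.

(** Induction on the order through (f^-1)' = - f^-1 f' f^-1, which comes from differentiating f f^-1
    = 1. Only plain differentiability of the inverse goes back to the adjugate formula. *)
Lemma ck_invmx m k D (f : E -> 'M[R]_m) : open D ->
  (forall x, D x -> f x \in unitmx) -> ck k D f ->
  ck k D (fun x => invmx (f x)).
Proof.
move=> oD fu; elim: k => [|k IHk] ckf; have [df ckf'] := ckf.
  split=> // x Dx; apply: differentiable_invmx; first exact: df.
  by apply: filterS (near_open oD Dx).
have dV x : D x -> differentiable (fun x => invmx (f x)) x.
  move=> Dx; apply: differentiable_invmx; first exact: df.
  by apply: filterS (near_open oD Dx).
split=> // j; have ckV := IHk (ckS ckf).
have := ckN oD (ck_mulmx oD ckV (ck_mulmx oD (ckf' j) ckV)).
apply: ck_ext => // x Dx; apply/eqP; rewrite eq_sym -addr_eq0 addrC; apply/eqP.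
have : 'D_(basis_vec j) (fun y => f y *m invmx (f y)) x = 0.
  rewrite (@near_eq_derive _ _ _ _ (cst 1%:M)) ?derive_cst//.
  by apply: filterS (near_open oD Dx) => y Dy; rewrite mulmxV//; exact: fu.
rewrite (derive_mulmx _ (df _ Dx) (dV _ Dx)).
move=> /(congr1 (mulmx (invmx (f x)))).
by rewrite mulmx0 mulmxDr mulKmx ?fu.
Qed.

End Smooth.

(** * Bilinear forms *)

Section BilinearForms.
Context {R : realType} {n : nat}.
Implicit Types (A B : 'M[R]_n) (u v w : 'rV[R]_n).

Lemma eval2Dl B u u' v : eval2 B (u + u') v = eval2 B u v + eval2 B u' v.
Proof. by rewrite /eval2 !mulmxDl mxE. Qed.

Lemma eval2Dr B u v v' : eval2 B u (v + v') = eval2 B u v + eval2 B u v'.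
Proof. by rewrite /eval2 linearD mulmxDr mxE. Qed.

Lemma eval2Zl B a u v : eval2 B (a *: u) v = a * eval2 B u v.
Proof. by rewrite /eval2 -!scalemxAl mxE. Qed.

Lemma eval2Zr B a u v : eval2 B u (a *: v) = a * eval2 B u v.
Proof. by rewrite /eval2 linearZ -scalemxAr mxE. Qed.

Lemma eval2Nl B u v : eval2 B (- u) v = - eval2 B u v.
Proof. by rewrite -scaleN1r eval2Zl mulN1r. Qed.

Lemma eval2Nr B u v : eval2 B u (- v) = - eval2 B u v.
Proof. by rewrite -scaleN1r eval2Zr mulN1r. Qed.

Lemma eval2Dm A B u v : eval2 (A + B) u v = eval2 A u v + eval2 B u v.
Proof. by rewrite /eval2 mulmxDr mulmxDl mxE. Qed.

Lemma eval2Nm A u v : eval2 (- A) u v = - eval2 A u v.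
Proof. by rewrite /eval2 mulmxN mulNmx mxE. Qed.

Lemma eval2Zm a A u v : eval2 (a *: A) u v = a * eval2 A u v.
Proof. by rewrite /eval2 -scalemxAr -scalemxAl mxE. Qed.

Lemma eval2_tr B u v : eval2 B^T u v = eval2 B v u.
Proof.
have -> : eval2 B^T u v = (v *m B *m u^T)^T 0 0.
  by rewrite !trmx_mul trmxK mulmxA.
by rewrite mxE.
Qed.

Lemma eval2_mulml (T : 'M[R]_n) B u v : eval2 (T *m B) u v = eval2 B (u *m T) v.
Proof. by rewrite /eval2 !mulmxA. Qed.

Lemma eval2_mulmr (T : 'M[R]_n) B u v : eval2 (B *m T^T) u v = eval2 B u (v *m T).
Proof. by rewrite /eval2 trmx_mul !mulmxA. Qed.

Lemma eval2_invmx B u v : B \in unitmx ->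
  eval2 B (u *m invmx B) v = (u *m v^T) 0 0.
Proof. by move=> Bu; rewrite /eval2 mulmxKV. Qed.

Lemma eval2_basis B j k : eval2 B (basis_vec j) (basis_vec k) = B j k.
Proof. by rewrite /eval2 /basis_vec trmx_delta -rowE -colE !mxE. Qed.

Lemma eval2_eqP A B : (forall u v, eval2 A u v = eval2 B u v) -> A = B.
Proof. by move=> AB; apply/matrixP => i j; rewrite -!eval2_basis AB. Qed.

Lemma eval2_nondeg B u u' : B \in unitmx ->
  (forall v, eval2 B u v = eval2 B u' v) -> u = u'.
Proof.
move=> Bu uu'; apply: (can_inj (mulmxK Bu)); apply/rowP => k.
have := uu' (basis_vec k).
by rewrite /eval2 /basis_vec trmx_delta -!colE !mxE.
Qed.

Lemma pairing_basis (a : 'cV[R]_n) j : pairing a (basis_vec j) = a j 0.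
Proof. by rewrite /pairing /basis_vec -rowE mxE. Qed.

Lemma pairingDl (a b : 'cV[R]_n) v : pairing (a + b) v = pairing a v + pairing b v.
Proof. by rewrite /pairing mulmxDr mxE. Qed.

Lemma pairingNl (a : 'cV[R]_n) v : pairing (- a) v = - pairing a v.
Proof. by rewrite /pairing mulmxN mxE. Qed.

Lemma pairingZl c (a : 'cV[R]_n) v : pairing (c *: a) v = c * pairing a v.
Proof. by rewrite /pairing -scalemxAr mxE. Qed.

Lemma pairing_mulmx (T : 'M[R]_n) (a : 'cV[R]_n) v :
  pairing (T *m a) v = pairing a (v *m T).
Proof. by rewrite /pairing mulmxA. Qed.

Lemma pairing_contract2 B u v : pairing (contract2 u B) v = eval2 B u v.
Proof. by rewrite -eval2_tr /pairing /contract2 /eval2 trmx_mul mulmxA. Qed.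

Lemma pairing_mulmx_tr B u v : pairing (B *m u^T) v = eval2 B v u.
Proof. by rewrite /pairing /eval2 mulmxA. Qed.

Lemma pairing_tr_mulmx B u v : pairing (u *m B)^T v = eval2 B u v.
Proof. exact: pairing_contract2. Qed.

Lemma pairing_tr u v : pairing u^T v = (u *m v^T) 0 0.
Proof. by rewrite /pairing -[v in LHS]trmxK -trmx_mul mxE. Qed.

(** The column is the transpose of [f] applied to [a]; this evaluates the terms w_i d_j X^i of a Lie
    derivative. *)
Lemma pairing_colE (a : 'cV[R]_n) (f : 'rV[R]_n -> 'rV[R]_n) v : linear f ->
  pairing (\col_j pairing a (f (basis_vec j))) v = pairing a (f v).
Proof.
move=> lf; pose L : {linear 'rV[R]_n -> 'rV[R]_n} :=
  HB.pack f (GRing.isLinear.Build _ _ _ _ f lf).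
rewrite -[f]/(L : _ -> _) [in RHS](row_sum_delta v) linear_sum.
rewrite /pairing mulmx_suml summxE mxE; apply: eq_bigr => j _.
by rewrite linearZ -scalemxAl [RHS]mxE; congr (_ * _); rewrite mxE.
Qed.

Lemma pairing_eqP (a b : 'cV[R]_n) : (forall v, pairing a v = pairing b v) -> a = b.
Proof. by move=> ab; apply/colP => j; rewrite -!pairing_basis. Qed.

End BilinearForms.

(** * Derivatives of forms and along vector fields in the model space *)

Section ModelSpace.
Context {R : realType} {n : nat}.
Local Notation E := 'rV[R]_n.

Lemma derive_eval2 (B : E -> 'M[R]_n) (X Y : E -> E) x v :
  differentiable B x -> differentiable X x -> differentiable Y x ->
  'D_v (fun y => eval2 (B y) (X y) (Y y)) x =
  eval2 ('D_v B x) (X x) (Y x) + eval2 (B x) ('D_v X x) (Y x)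
  + eval2 (B x) (X x) ('D_v Y x).
Proof.
move=> dB dX dY; have dXB := differentiable_mulmx dX dB.
have dYT := differentiable_trmx dY.
rewrite -derive_mxE; last exact: differentiable_mulmx.
rewrite (derive_mulmx _ dXB dYT) (derive_mulmx _ dX dB) (derive_trmx _ dY).
by rewrite mulmxDl [LHS]mxE [X in X + _]mxE [X in X + _]addrC.
Qed.

Lemma derive_eval2_cst (B : E -> 'M[R]_n) u w x v :
  differentiable B x ->
  'D_v (fun y => eval2 (B y) u w) x = eval2 ('D_v B x) u w.
Proof.
move=> dB; have dc (c : E) : differentiable (fun=> c : E) x.
  exact: differentiable_cst.
rewrite (derive_eval2 v dB (dc u) (dc w)) !derive_cst.
by rewrite {2 3}/eval2 trmx0 mulmx0 !mul0mx !mxE !addr0.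
Qed.

(** Entrywise the derivative is the product of the row [X x] with a gradient, so only [f] loses an
    order of differentiability. *)
Lemma ck_derive_field m p k D (X : E -> E) (f : E -> 'M[R]_(m, p)) :
  open D -> ck k D X -> ck k.+1 D f -> ck k D (fun x => 'D_(X x) f x).
Proof.
move=> oD cX [df cf]; apply: ck_mx => // i j.
have cg : ck k D (fun x => grad (fun y => f y i j) x).
  apply: ck_mx => // l i'; apply: ck_ext (ck_entry i j oD (cf l)) => // x Dx.
  by rewrite mxE derive_mxE//; exact: df.
apply: ck_ext (ck_entry 0 0 oD (ck_mulmx oD cX cg)) => // x Dx.
rewrite (derive_mxE _ _ _ (df _ Dx)) derive_pairing//.
by have /differentiable_mxP := df _ Dx; exact.
Qed.

Lemma ck_derive m p k D u (f : E -> 'M[R]_(m, p)) :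
  open D -> ck k.+1 D f -> ck k D ('D_u f).
Proof. by move=> oD cf; exact: ck_derive_field (ck_cst _ _ _) cf. Qed.

Lemma derive_mx_comm m p D (f : E -> 'M[R]_(m, p)) u v x :
  open D -> ck 1 D f -> D x -> 'D_v ('D_u f) x = 'D_u ('D_v f) x.
Proof.
move=> oD cf Dx; have df y : D y -> differentiable f y by exact: ck_diff cf.
have d2 w : differentiable ('D_w f) x by exact: ck_diff (ck_derive w oD cf) Dx.
apply/matrixP => i j.
have e1 := derive_mxE v i j (d2 u).
have e2 := derive_mxE u i j (d2 v).
transitivity ('D_v (fun y => 'D_u f y i j) x); first exact: e1.
transitivity ('D_u (fun y => 'D_v f y i j) x); last exact: esym e2.
have E1 w t : 'D_t (fun y => 'D_w f y i j) x = 'D_t ('D_w (fun y => f y i j)) x.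
  apply: near_eq_derive; apply: filterS (near_open oD Dx) => y Dy.
  exact: (derive_mxE w i j (df _ Dy)).
have E2 w : differentiable ('D_w (fun y => f y i j)) x.
  apply: near_eq_differentiable ((differentiable_mxP _ _).1 (d2 w) i j).
  by apply: filterS (near_open oD Dx) => y Dy; exact: (derive_mxE w i j (df _ Dy)).
apply: etrans (E1 u v) (etrans _ (esym (E1 v u))).
apply: derive_comm; [|exact: E2..].
apply: filterS (near_open oD Dx) => y Dy.
by have /differentiable_mxP := df _ Dy; exact.
Qed.

Lemma ext_deriv1_coordE (w : E -> 'cV[R]_n) x u v : differentiable w x ->
  eval2 (ext_deriv1_coord w x) u v =
  pairing ('D_u w x) v - pairing ('D_v w x) u.
Proof.
move=> dw; pose L := \matrix_(j, k) ('D_(basis_vec j) w x) k 0.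
have LE s t : eval2 L s t = pairing ('D_s w x) t.
  rewrite -pairing_contract2; congr pairing.
  rewrite [in RHS](row_sum_delta s) deriveE// linear_sum.
  apply/colP => k; rewrite mxE mxE summxE; apply: eq_bigr => j _.
  by rewrite linearZ mxE mxE -deriveE.
have -> : ext_deriv1_coord w x = L - L^T by apply/matrixP => j k; rewrite !mxE.
by rewrite eval2Dm eval2Nm eval2_tr !LE.
Qed.

End ModelSpace.

(** * The one-form of the Courant bracket in the model space *)

Section Koszul.
Context {R : realType} {n : nat}.
Local Notation E := 'rV[R]_n.
Implicit Types (C : E -> 'M[R]_n) (X Y Z : E -> E) (x u w : E).

(* 2 g(D_u Y, w) + u^i Y^j w^k (d_i C_jk + d_j C_ki - d_k C_ji) with          *)
(* g = (C + C^T) / 2.                                                         *)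
Definition koszul C u Y x w : R :=
  eval2 (C x + (C x)^T) ('D_u Y x) w + eval2 ('D_u C x) (Y x) w
  + eval2 ('D_(Y x) C x) w u - eval2 ('D_w C x) (Y x) u.

Lemma near_eq_koszul_form C C' Y u x w : (\near x, C x = C' x) ->
  koszul C u Y x w = koszul C' u Y x w.
Proof.
move=> CC'; rewrite /koszul (nbhs_singleton CC').
by rewrite (near_eq_derive u CC') (near_eq_derive w CC') (near_eq_derive (Y x) CC').
Qed.

Lemma near_eq_koszul_field C Y Y' u x w : (\near x, Y x = Y' x) ->
  koszul C u Y x w = koszul C u Y' x w.
Proof.
move=> YY'; rewrite /koszul (nbhs_singleton YY').
by rewrite (near_eq_derive u YY').
Qed.

Lemma derive_tr_sum C x v : differentiable C x ->
  'D_v (fun y => C y + (C y)^T) x = 'D_v C x + ('D_v C x)^T.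
Proof.
move=> dC; have dCT := differentiable_trmx dC.
rewrite -(derive_trmx _ dC); apply: deriveD; exact: diff_derivable.
Qed.

(** Exchanging [Y x] and [Z x] exchanges the last two terms of [koszul] with opposite signs, so they
    cancel in the sum. *)
Lemma koszul_metric C u Y Z x : differentiable C x ->
  differentiable Y x -> differentiable Z x ->
  'D_u (fun y => eval2 (C y + (C y)^T) (Y y) (Z y)) x =
  koszul C u Y x (Z x) + koszul C u Z x (Y x).
Proof.
move=> dC dY dZ; have dS : differentiable (fun y => C y + (C y)^T) x.
  by apply: differentiableD => //; exact: differentiable_trmx.
rewrite (derive_eval2 u dS dY dZ) (derive_tr_sum _ dC) /koszul.
have Ssym (a b : E) : eval2 (C x + (C x)^T) a b = eval2 (C x + (C x)^T) b a.
  by rewrite !eval2Dm !eval2_tr addrC.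
rewrite [eval2 _ ('D_u Z x) (Y x)]Ssym (eval2Dm ('D_u C x)) eval2_tr.
have alg (a b c d e f : R) :
  a + b + c + d = (c + a + e - f) + (d + b + f - e) by ring.
exact: alg.
Qed.

Lemma koszulD_dir C Y x u u' w : differentiable C x -> differentiable Y x ->
  koszul C (u + u') Y x w = koszul C u Y x w + koszul C u' Y x w.
Proof.
move=> dC dY; rewrite /koszul !(derive_addv _ _ dC) (derive_addv _ _ dY).
move: ('D_u Y x) ('D_u' Y x) ('D_u C x) ('D_u' C x) ('D_(Y x) C x) ('D_w C x).
move=> a a' b b' c d; rewrite eval2Dl !eval2Dr (eval2Dm b).
have alg (p p' q q' r r' s s' : R) : p + p' + (q + q') + (r + r') - (s + s') =
  p + q + r - s + (p' + q' + r' - s') by ring.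
exact: alg.
Qed.

Lemma koszulZ_dir C Y x k u w : differentiable C x -> differentiable Y x ->
  koszul C (k *: u) Y x w = k * koszul C u Y x w.
Proof.
move=> dC dY; rewrite /koszul !(derive_scalev _ _ dC) (derive_scalev _ _ dY).
move: ('D_u Y x) ('D_u C x) ('D_(Y x) C x) ('D_w C x).
move=> a b c d; rewrite eval2Zl !eval2Zr eval2Zm.
have alg (p q r s : R) : k * p + k * q + k * r - k * s =
  k * (p + q + r - s) by ring.
exact: alg.
Qed.

Lemma koszulD_covec C Y x u w w' : differentiable C x ->
  koszul C u Y x (w + w') = koszul C u Y x w + koszul C u Y x w'.
Proof.
move=> dC; rewrite /koszul !(derive_addv _ _ dC).
move: ('D_u Y x) ('D_u C x) ('D_(Y x) C x) ('D_w C x) ('D_w' C x).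
move=> a b c d d'; rewrite !eval2Dr eval2Dl (eval2Dm d).
have alg (p p' q q' r r' s s' : R) : p + p' + (q + q') + (r + r') - (s + s') =
  p + q + r - s + (p' + q' + r' - s') by ring.
exact: alg.
Qed.

Lemma koszulZ_covec C Y x u k w : differentiable C x ->
  koszul C u Y x (k *: w) = k * koszul C u Y x w.
Proof.
move=> dC; rewrite /koszul !(derive_scalev _ _ dC).
move: ('D_u Y x) ('D_u C x) ('D_(Y x) C x) ('D_w C x).
move=> a b c d; rewrite !eval2Zr eval2Zl eval2Zm.
have alg (p q r s : R) : k * p + k * q + k * r - k * s =
  k * (p + q + r - s) by ring.
exact: alg.
Qed.

Lemma koszulD C Y Y' x u w : differentiable C x ->
  differentiable Y x -> differentiable Y' x ->
  koszul C u (fun y => Y y + Y' y) x w = koszul C u Y x w + koszul C u Y' x w.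
Proof.
move=> dC dY dY'; rewrite /koszul !(derive_addv _ _ dC).
have -> : 'D_u (fun y => Y y + Y' y) x = 'D_u Y x + 'D_u Y' x.
  by apply: deriveD; exact: diff_derivable.
move: ('D_u Y x) ('D_u Y' x) ('D_u C x) ('D_(Y x) C x) ('D_(Y' x) C x) ('D_w C x).
move=> a a' b c c' d; rewrite !eval2Dl (eval2Dm c).
have alg (p p' q q' r r' s s' : R) : p + p' + (q + q') + (r + r') - (s + s') =
  p + q + r - s + (p' + q' + r' - s') by ring.
exact: alg.
Qed.

Lemma koszulZ C Y (f : E -> R) x u w : differentiable C x ->
  differentiable Y x -> differentiable f x ->
  koszul C u (fun y => f y *: Y y) x w =
  'D_u f x * eval2 (C x + (C x)^T) (Y x) w + f x * koszul C u Y x w.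
Proof.
move=> dC dY df; rewrite /koszul !(derive_scalev _ _ dC).
(* Scaling by [f] is written as a product with a 1 by 1 matrix, so that the Leibniz rule for matrix
   products applies. *)
have dfM : differentiable (fun y => (f y)%:M : 'M[R]_1) x.
  apply/differentiable_mxP => i j; rewrite !ord1.
  by under [X in differentiable X _]eq_fun do rewrite mxE eqxx mulr1n.
have -> : 'D_u (fun y => f y *: Y y) x = 'D_u f x *: Y x + f x *: 'D_u Y x.
  have -> : (fun y => f y *: Y y) = (fun y => (f y)%:M *m Y y).
    by apply/funext => y; rewrite mul_scalar_mx.
  rewrite (derive_mulmx _ dfM dY) mul_scalar_mx -[in RHS]mul_scalar_mx.
  congr (_ *m _ + _); apply/matrixP => i j; rewrite (derive_mxE _ _ _ dfM) !ord1.
  by under eq_fun do rewrite mxE eqxx mulr1n; rewrite mxE eqxx mulr1n.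
move: ('D_u f x) ('D_u Y x) ('D_u C x) ('D_(Y x) C x) ('D_w C x).
move=> k a b c d; rewrite !eval2Dl !eval2Zl eval2Zm.
have alg (l p p' q r s : R) : k * p' + l * p + l * q + l * r - l * s =
  k * p' + l * (p + q + r - s) by ring.
exact: alg.
Qed.

(** The terms in derivatives of [X] and [Y] form the Lie bracket and drop out. What is left is the
    cyclic sum of derivatives of C - C^T, which is twice the curving; this 2 matches C + C^T = 2 g
    on the left. *)
Lemma koszul_torsion C X Y x w : differentiable C x ->
  differentiable X x -> differentiable Y x ->
  koszul C (X x) Y x w - koszul C (Y x) X x w
    - eval2 (C x + (C x)^T) (lie_coord X Y x) w =
  2 * ext_deriv2_coord (fun y => 2^-1 *: (C y - (C y)^T)) x (X x) (Y x) w.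
Proof.
move=> dC dX dY; have dCT := differentiable_trmx dC.
have dB : differentiable (fun y => 2^-1 *: (C y - (C y)^T)) x.
  by apply: differentiableZ; exact: differentiableB.
have DB v : 'D_v (fun y => 2^-1 *: (C y - (C y)^T)) x =
    2^-1 *: ('D_v C x - ('D_v C x)^T).
  rewrite -(derive_trmx _ dC) -deriveB; [|exact: diff_derivable..].
  by apply: deriveZ; apply: diff_derivable; exact: differentiableB.
rewrite /ext_deriv2_coord !(derive_eval2_cst _ _ _ dB) !DB /koszul /lie_coord.
move: ('D_(X x) C x) ('D_(Y x) C x) ('D_w C x) ('D_(X x) Y x) ('D_(Y x) X x).
move=> a b c d d'.
rewrite !eval2Zm !(eval2Dm a, eval2Dm b, eval2Dm c) !eval2Nm !eval2_tr.
rewrite eval2Dl eval2Nl.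
have alg (p p' q q' r r' s s' : R) :
  p + q + r - s - (p' + r' + q' - s') - (p - p') =
  2 * (2^-1 * (q - q') + 2^-1 * (r - r') + 2^-1 * (s' - s)) by field.
exact: alg.
Qed.

(** * Change of coordinates, and shifts by closed two-forms *)

Lemma derive_jacobian (f : E -> E) x v :
  differentiable f x -> 'D_v f x = v *m 'J f x.
Proof. exact: deriveEjacobian. Qed.

Lemma ck_jacobian k D (psi : E -> E) : open D -> ck k.+1 D psi ->
  ck k D (fun y => 'J psi y).
Proof.
move=> oD [dpsi cpsi]; apply: ck_mx => // i j.
apply: ck_ext (ck_entry 0 j oD (cpsi i)) => // x Dx.
by rewrite (derive_jacobian _ (dpsi _ Dx)) /basis_vec -rowE mxE.
Qed.

(** Both sides are second derivatives of [psi], since u J is the derivative of [psi] along the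
    constant vector [u]. *)
Lemma jacobian_comm D (psi : E -> E) x u v : open D -> ck 1 D psi -> D x ->
  u *m 'D_v (fun y => 'J psi y) x = v *m 'D_u (fun y => 'J psi y) x.
Proof.
move=> oD cpsi Dx; have dJ := ck_diff (ck_jacobian oD cpsi) Dx.
have [dpsi _] := cpsi.
have JE s t : s *m 'D_t (fun y => 'J psi y) x = 'D_t ('D_s psi) x.
  have dc : differentiable (fun=> s : E) x by exact: differentiable_cst.
  transitivity ('D_t (fun y => s *m 'J psi y) x).
    by rewrite (derive_mulmx t dc dJ) derive_cst mul0mx add0r.
  apply: near_eq_derive; apply: filterS (near_open oD Dx) => y Dy.
  by rewrite (derive_jacobian _ (dpsi _ Dy)).
by rewrite !JE; exact: derive_mx_comm cpsi Dx.
Qed.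

Lemma derive_congruence D (psi : E -> E) C C' x a b v : open D -> ck 1 D psi ->
  D x -> differentiable C' (psi x) ->
  (forall y, D y -> C y = 'J psi y *m C' (psi y) *m ('J psi y)^T) ->
  eval2 ('D_v C x) a b =
  eval2 (C' (psi x)) (a *m 'D_v (fun y => 'J psi y) x) (b *m 'J psi x)
  + eval2 ('D_(v *m 'J psi x) C' (psi x)) (a *m 'J psi x) (b *m 'J psi x)
  + eval2 (C' (psi x)) (a *m 'J psi x) (b *m 'D_v (fun y => 'J psi y) x).
Proof.
move=> oD cpsi Dx dC' CC'.
have dJ := ck_diff (ck_jacobian oD cpsi) Dx.
have dpsi := ck_diff cpsi Dx.
have dCp : differentiable (C' \o psi) x by exact: differentiable_comp.
have dJC := differentiable_mulmx dJ dCp; have dJT := differentiable_trmx dJ.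
have -> : 'D_v C x = 'D_v (fun y => 'J psi y *m C' (psi y) *m ('J psi y)^T) x.
  by apply: near_eq_derive; exact: filterS (near_open oD Dx).
rewrite (derive_mulmx v dJC dJT) (derive_mulmx v dJ dCp) (derive_trmx v dJ).
rewrite (derive_chain v dpsi dC') (derive_jacobian _ dpsi).
move: ('D_v _ x) ('J psi x) ('D_(v *m _) C' _) => K J D'.
by rewrite eval2Dm !eval2_mulmr eval2Dm !eval2_mulml.
Qed.

(** Differentiating J C' J^T produces six terms in the Hessian of [psi]. By symmetry of the Hessian
    four of them cancel in pairs, and the other two equal the Hessian term of D_u Y' paired through
    C' + C'^T. *)
Lemma koszul_change D (psi : E -> E) C C' Y Y' x u w : open D -> ck 1 D psi ->
  D x -> differentiable C' (psi x) ->
  differentiable Y x -> differentiable Y' (psi x) ->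
  (forall y, D y -> C y = 'J psi y *m C' (psi y) *m ('J psi y)^T) ->
  (forall y, D y -> Y' (psi y) = Y y *m 'J psi y) ->
  koszul C u Y x w = koszul C' (u *m 'J psi x) Y' (psi x) (w *m 'J psi x).
Proof.
move=> oD cpsi Dx dC' dY dY' CC' YY'.
have dJ := ck_diff (ck_jacobian oD cpsi) Dx.
have dpsi := ck_diff cpsi Dx.
have DY : 'D_(u *m 'J psi x) Y' (psi x) =
    'D_u Y x *m 'J psi x + Y x *m 'D_u (fun y => 'J psi y) x.
  rewrite -(derive_jacobian u dpsi) -(derive_chain u dpsi dY').
  rewrite -(derive_mulmx u dY dJ).
  by apply: near_eq_derive; exact: filterS (near_open oD Dx).
have comm p q : p *m 'D_q (fun y => 'J psi y) x = q *m 'D_p (fun y => 'J psi y) x.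
  exact: jacobian_comm oD cpsi Dx.
rewrite /koszul DY (YY' _ Dx).
have := derive_congruence (Y x) w u oD cpsi Dx dC' CC'.
have := derive_congruence w u (Y x) oD cpsi Dx dC' CC'.
have := derive_congruence (Y x) u w oD cpsi Dx dC' CC'.
move: ('D_u C x) ('D_(Y x) C x) ('D_w C x) => e f g -> -> ->.
rewrite (CC' _ Dx).
have := comm (Y x) w; have := comm w u; have := comm u (Y x).
move: ('D_u Y x) ('D_(u *m 'J psi x) C' (psi x))
  ('D_(Y x *m 'J psi x) C' (psi x)) ('D_(w *m 'J psi x) C' (psi x)).
move: ('D_(Y x) (fun y => 'J psi y) x) ('D_u (fun y => 'J psi y) x)
  ('D_w (fun y => 'J psi y) x) => k1 k2 k3 a b c d.
move: ('J psi x) (C' (psi x)) (Y x) => J B v c1 c2 c3.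
rewrite c1 c2 c3 !eval2Dm !eval2_tr !eval2_mulmr !eval2_mulml eval2Dl eval2Dr.
have alg (p p' q q' r r' s s' t : R) :
  p + p' + (q + r + s) + (t + r' + q') - (t + s' + s) =
  p + q + (p' + q') + r + r' - s' by ring.
exact: alg.
Qed.

(** The added two-form da is antisymmetric, so it does not change C + C^T, and its derivatives
    contribute d(da)(u, Y, w) = 0. *)
Lemma koszul_addl_closed D C (a : E -> 'cV[R]_n) Y x u w : open D -> ck 2 D a ->
  D x -> differentiable C x ->
  koszul (fun y => C y + ext_deriv1_coord a y) u Y x w = koszul C u Y x w.
Proof.
move=> oD ca Dx dC; set F := ext_deriv1_coord a.
have da y : D y -> differentiable a y by exact: ck_diff ca.
have dDa v : differentiable ('D_v a) x.
  exact: ck_diff (ck_derive v oD (ckS ca)) Dx.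
have FE : forall y, D y -> forall s t, eval2 (F y) s t =
    pairing ('D_s a y) t - pairing ('D_t a y) s.
  by move=> y Dy s t; rewrite ext_deriv1_coordE//; exact: da.
have dF : differentiable F x.
  apply/differentiable_mxP => i j.
  apply: (@near_eq_differentiable _ _ _
    (fun y => ('D_(basis_vec i) a y) j 0 - ('D_(basis_vec j) a y) i 0)).
    by apply: filterS (near_open oD Dx) => y Dy; rewrite mxE.
  by apply: differentiableB; exact: (differentiable_mxP _ _).1.
have DF v s t : eval2 ('D_v F x) s t =
    pairing ('D_v ('D_s a) x) t - pairing ('D_v ('D_t a) x) s.
  have dp p q : differentiable (fun y => pairing ('D_p a y) q) x.
    have dc : differentiable (fun=> q : E) x by exact: differentiable_cst.
    by have /differentiable_mxP := differentiable_mulmx dc (dDa p); exact.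
  have Dp p q : 'D_v (fun y => pairing ('D_p a y) q) x = pairing ('D_v ('D_p a) x) q.
    have dc : differentiable (fun=> q : E) x by exact: differentiable_cst.
    rewrite -(derive_mxE _ _ _ (differentiable_mulmx dc (dDa p))).
    by rewrite (derive_mulmx _ dc (dDa p)) derive_cst mul0mx add0r.
  have dpv p q : derivable (fun y => pairing ('D_p a y) q) x v.
    exact: diff_derivable (dp p q).
  rewrite -(derive_eval2_cst s t v dF).
  transitivity ('D_v ((fun y => pairing ('D_s a y) t) -
      (fun y => pairing ('D_t a y) s)) x).
    apply: near_eq_derive; apply: filterS (near_open oD Dx) => y Dy; exact: FE.
  by rewrite (deriveB (dpv s t) (dpv t s)); congr (_ - _); exact: Dp.
(* From here on only the symmetry of the second derivatives of [a] is kept. *)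
have [d [Dd comm]] : exists d : E -> E -> 'cV[R]_n,
    (forall v s t, eval2 ('D_v F x) s t = pairing (d s v) t - pairing (d t v) s)
    /\ (forall p q, d p q = d q p).
  exists (fun p q => 'D_q ('D_p a) x); split; first exact: DF.
  by move=> p q; exact: derive_mx_comm (ckS ca) Dx.
have DS v : 'D_v (fun y => C y + F y) x = 'D_v C x + 'D_v F x.
  by apply: deriveD; exact: diff_derivable.
have FT : (F x)^T = - F x.
  by apply: eval2_eqP => s t; rewrite eval2Nm eval2_tr !FE// opprB.
rewrite /koszul !DS linearD/= FT addrACA subrr addr0.
have := Dd w (Y x) u; have := Dd (Y x) w u; have := Dd u (Y x) w.
move: ('D_u C x) ('D_(Y x) C x) ('D_w C x) ('D_u Y x)
  ('D_u F x) ('D_(Y x) F x) ('D_w F x) => c1 c2 c3 y f1 f2 f3.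
move=> e1 e2 e3; rewrite (eval2Dm c1) (eval2Dm c2) (eval2Dm c3) e1 e2 e3.
rewrite (comm u w) (comm u (Y x)) (comm w (Y x)).
have alg (p q r s e f g : R) :
  p + (q + (e - f)) + (r + (g - e)) - (s + (g - f)) = p + q + r - s by ring.
exact: alg.
Qed.

(** * The connection and the Courant bracket in the model space *)

Lemma koszul_row C Y x u w : differentiable C x ->
  koszul C u Y x w = ((\row_k koszul C u Y x (basis_vec k)) *m w^T) 0 0.
Proof.
move=> dC; rewrite {1}[w]row_sum_delta mxE.
have K0 : koszul C u Y x 0 = 0.
  by rewrite -[X in koszul C u Y x X](scale0r (0 : E)) koszulZ_covec// mul0r.
rewrite (big_morph (koszul C u Y x) (fun w w' => koszulD_covec _ _ w w' dC) K0).
by apply: eq_bigr => k _; rewrite koszulZ_covec// !mxE mulrC.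
Qed.

(** The index is raised with C + C^T = 2 g, which absorbs the factor 2 in front of g(D_u Y, w) in
    [koszul]. Entries of the row of this shape are twice Christoffel symbols of the first kind plus
    derivatives of [Y]. *)
Definition koszul_connection C u Y x : E :=
  (\row_k koszul C u Y x (basis_vec k)) *m invmx (C x + (C x)^T).

Lemma koszul_connection_congr C C' u Y Y' x :
  C x + (C x)^T = C' x + (C' x)^T ->
  (forall w, koszul C u Y x w = koszul C' u Y' x w) ->
  koszul_connection C u Y x = koszul_connection C' u Y' x.
Proof.
move=> SS' KK'.
have rowE : \row_k koszul C u Y x (basis_vec k) =
    \row_k koszul C' u Y' x (basis_vec k).
  by apply/rowP => k; rewrite mxE [RHS]mxE; exact: KK'.
exact: (congr2 (fun r S => r *m invmx S) rowE SS').
Qed.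

Lemma koszul_connectionK C u Y x : C x + (C x)^T \in unitmx ->
  koszul_connection C u Y x *m (C x + (C x)^T) =
  \row_k koszul C u Y x (basis_vec k).
Proof. by move=> Su; rewrite /koszul_connection mulmxKV. Qed.

Lemma eval2_koszul_connection C u Y x w : differentiable C x ->
  C x + (C x)^T \in unitmx ->
  eval2 (C x + (C x)^T) (koszul_connection C u Y x) w = koszul C u Y x w.
Proof.
move=> dC Su; rewrite (koszul_row _ _ _ dC) /koszul_connection.
exact: eval2_invmx.
Qed.

Lemma ck_koszul_connection k D C X Y : open D -> ck k.+1 D C -> ck k D X ->
  ck k.+1 D Y -> (forall x, D x -> C x + (C x)^T \in unitmx) ->
  ck k D (fun x => koszul_connection C (X x) Y x).
Proof.
move=> oD cC cX cY Su.
have cS : ck k.+1 D (fun x => C x + (C x)^T).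
  by apply: ckD => //; exact: ck_trmx.
apply: ck_mulmx => //; last by apply: ck_invmx => //; exact: ckS.
apply: ck_mx => // i j.
have cj : ck k D (fun=> basis_vec j : E) by exact: ck_cst.
pose ev (B : E -> 'M[R]_n) (u v : E -> E) x := (u x *m B x *m (v x)^T) 0 0.
have cev (B : E -> 'M[R]_n) (u v : E -> E) :
    ck k D B -> ck k D u -> ck k D v -> ck k D (ev B u v).
  move=> cB cu cv; apply: ck_entry => //; apply: ck_mulmx => //.
    exact: ck_mulmx.
  exact: ck_trmx.
have cDY := ck_derive_field oD cX cY; have cDC := ck_derive_field oD cX cC.
have cDYC := ck_derive_field oD (ckS cY) cC.
have cDjC := ck_derive_field oD cj cC.
have c1 := cev _ _ _ (ckS cS) cDY cj; have c2 := cev _ _ _ cDC (ckS cY) cj.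
have c3 := cev _ _ _ cDYC cj cX; have c4 := cev _ _ _ cDjC (ckS cY) cX.
have := ckD oD (ckD oD (ckD oD c1 c2) c3) (ckN oD c4).
by apply: ck_ext => // x Dx; rewrite mxE.
Qed.

(** Both sides are tested against C' + C'^T, which is nondegenerate. As the Jacobian is invertible,
    every test vector is the image of one at [x], where [koszul_change] applies. *)
Lemma koszul_connection_change D (psi : E -> E) C C' Y Y' x u : open D ->
  ck 1 D psi -> D x -> differentiable C x -> differentiable C' (psi x) ->
  differentiable Y x -> differentiable Y' (psi x) ->
  (forall y, D y -> C y = 'J psi y *m C' (psi y) *m ('J psi y)^T) ->
  (forall y, D y -> Y' (psi y) = Y y *m 'J psi y) ->
  'J psi x \in unitmx -> C x + (C x)^T \in unitmx ->
  C' (psi x) + (C' (psi x))^T \in unitmx ->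
  koszul_connection C u Y x *m 'J psi x =
  koszul_connection C' (u *m 'J psi x) Y' (psi x).
Proof.
move=> oD cpsi Dx dC dC' dY dY' CC' YY' Ju Su Su'.
apply: (eval2_nondeg Su') => v.
rewrite (eval2_koszul_connection _ _ _ dC' Su').
rewrite -[v in RHS](mulmxKV Ju).
rewrite -(koszul_change u (v *m invmx ('J psi x)) oD cpsi Dx dC' dY dY' CC' YY').
rewrite -(eval2_koszul_connection _ _ _ dC Su) (CC' _ Dx).
move: (koszul_connection _ _ _ _) ('J psi x) (C' (psi x)) Ju => a J B Ju.
by rewrite !eval2Dm !eval2_tr !eval2_mulmr !eval2_mulml mulmxKV.
Qed.

(* The one-form part of the Courant bracket of X + xi, xi = - C X^T and       *)
(* Y + eta, eta = C^T Y^T; all derivatives of X cancel up to C [X, Y]^T.      *)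
Lemma courant_coord_koszul C X Y (xi eta : E -> 'cV[R]_n) x :
  differentiable C x -> differentiable X x -> differentiable Y x ->
  (\near x, xi x = - (C x *m (X x)^T)) -> (\near x, eta x = (Y x *m C x)^T) ->
  courant_coord X xi Y eta x =
  (lie_coord X Y x,
   (\row_k koszul C (X x) Y x (basis_vec k))^T - C x *m (lie_coord X Y x)^T).
Proof.
move=> dC dX dY xiE etaE; rewrite /courant_coord; congr pair.
have dCX := differentiable_mulmx dC (differentiable_trmx dX).
have dYC := differentiable_mulmx dY dC.
have Dxi v : 'D_v xi x = - ('D_v C x *m (X x)^T + C x *m ('D_v X x)^T).
  rewrite -(derive_trmx v dX) -(derive_mulmx v dC (differentiable_trmx dX)).
  by rewrite (near_eq_derive _ xiE); apply: deriveN; exact: diff_derivable.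
have Deta v : 'D_v eta x = ('D_v Y x *m C x + Y x *m 'D_v C x)^T.
  rewrite -(derive_mulmx v dY dC) -(derive_trmx v dYC).
  exact: near_eq_derive etaE.
(* Both i_X eta and - i_Y xi equal C(Y, X), so the exact term of the bracket, with its factor 1/2,
   is dh. *)
pose h y := eval2 (C y) (Y y) (X y).
have dh : differentiable h x.
  have := differentiable_mulmx dYC (differentiable_trmx dX).
  by move=> /differentiable_mxP; exact.
have gradE v : pairing (2^-1 *: grad (fun y => pairing (eta y) (X y) -
    pairing (xi y) (Y y)) x) v = 'D_v h x.
  have hE : \near x, (h + h) x = pairing (eta x) (X x) - pairing (xi x) (Y x).
    apply: filterS2 xiE etaE => y -> ->.
    by rewrite pairingNl opprK pairing_mulmx_tr pairing_tr_mulmx.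
  rewrite pairingZl -derive_pairing; last first.
    by apply: near_eq_differentiable hE _; exact: differentiableD.
  have dhv : derivable h x v by exact: diff_derivable.
  rewrite -(near_eq_derive _ hE) (deriveD dhv dhv).
  have half (a : R) : 2^-1 * (a + a) = a by field.
  exact: half.
have derX : linear (fun v => 'D_v X x) by move=> k u v; exact: derive_linear.
have derY : linear (fun v => 'D_v Y x) by move=> k u v; exact: derive_linear.
apply: pairing_eqP => v; rewrite !pairingDl !pairingNl gradE.
rewrite (derive_eval2 v dC dY dX).
rewrite /lie_deriv_coord !pairingDl Dxi Deta.
rewrite (pairing_colE _ _ derX) (pairing_colE _ _ derY).
rewrite (nbhs_singleton xiE) (nbhs_singleton etaE).
rewrite pairing_tr -(koszul_row _ _ _ dC) /koszul /lie_coord.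
rewrite pairing_mulmx_tr.
move: ('D_(X x) Y x) ('D_(Y x) X x) ('D_(X x) C x) ('D_(Y x) C x)
  ('D_v C x) ('D_v X x) ('D_v Y x) => y1 x1 c1 c2 c3 x2 y2.
move: (C x) (X x) (Y x) => B u w; clear.
rewrite linearD/= !(pairingDl, pairingNl, pairing_mulmx_tr, pairing_tr_mulmx).
rewrite eval2Dm eval2_tr eval2Dr eval2Nr.
have alg (a b c d e f g k : R) :
  a + b + c - (- (d + e) - f) - (g + f + c) =
  a + k + b + d - g - (k - e) by ring.
exact: alg.
Qed.

End Koszul.

(** * Exterior derivatives: naturality and the angular form *)

Section ExteriorDerivative.
Context {R : realType} {n : nat}.
Local Notation E := 'rV[R]_n.

Lemma ext_deriv1_coordD (w w' : E -> 'cV[R]_n) x :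
  differentiable w x -> differentiable w' x ->
  ext_deriv1_coord (fun y => w y + w' y) x =
  ext_deriv1_coord w x + ext_deriv1_coord w' x.
Proof.
move=> dw dw'; have D v : 'D_v (fun y => w y + w' y) x = 'D_v w x + 'D_v w' x.
  by apply: deriveD; exact: diff_derivable.
have dww : differentiable (fun y => w y + w' y) x by exact: differentiableD.
apply: eval2_eqP => u v; rewrite eval2Dm (ext_deriv1_coordE u v dww).
rewrite (ext_deriv1_coordE u v dw) (ext_deriv1_coordE u v dw').
have := D u; have := D v.
move: ('D_u (fun y => w y + w' y) x) ('D_v (fun y => w y + w' y) x).
move: ('D_u w x) ('D_v w x) ('D_u w' x) ('D_v w' x); clear.
by move=> a b c d d1 d2 -> ->; rewrite !pairingDl opprD addrACA.
Qed.

(** The derivatives of the Jacobian contribute the Hessian of [psi] paired with a', which is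
    symmetric and vanishes on antisymmetrization. *)
Lemma ext_deriv1_change D (psi : E -> E) (a a' : E -> 'cV[R]_n) x :
  open D -> ck 1 D psi -> D x -> differentiable a' (psi x) ->
  (forall y, D y -> a y = 'J psi y *m a' (psi y)) ->
  ext_deriv1_coord a x =
  'J psi x *m ext_deriv1_coord a' (psi x) *m ('J psi x)^T.
Proof.
move=> oD cpsi Dx da' aa'.
have dJ := ck_diff (ck_jacobian oD cpsi) Dx.
have dpsi := ck_diff cpsi Dx.
have dap : differentiable (a' \o psi) x by exact: differentiable_comp.
have aE : \near x, 'J psi x *m (a' \o psi) x = a x.
  by apply: filterS (near_open oD Dx) => y Dy; rewrite aa'.
have da : differentiable a x.
  exact: near_eq_differentiable aE (differentiable_mulmx dJ dap).
have Da v : 'D_v a x = 'D_v (fun y => 'J psi y) x *m a' (psi x)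
    + 'J psi x *m 'D_(v *m 'J psi x) a' (psi x).
  rewrite -(near_eq_derive v aE) (derive_mulmx v dJ dap).
  by rewrite (derive_chain v dpsi da') (derive_jacobian v dpsi).
apply: eval2_eqP => u v; rewrite eval2_mulmr eval2_mulml.
rewrite (ext_deriv1_coordE _ _ da) (ext_deriv1_coordE _ _ da').
have := jacobian_comm u v oD cpsi Dx; rewrite !Da.
move: ('D_u (fun y => 'J psi y) x) ('D_v (fun y => 'J psi y) x)
  ('D_(u *m 'J psi x) a' (psi x)) ('D_(v *m 'J psi x) a' (psi x)) => k1 k2 b1 b2.
move: ('J psi x) (a' (psi x)) => J c; clear.
rewrite !pairingDl !pairing_mulmx => ->.
by rewrite opprD addrACA subrr add0r.
Qed.

Lemma derive_scalar_comm D (f : E -> R) u v x :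
  open D -> ck 1 D f -> D x -> 'D_v ('D_u f) x = 'D_u ('D_v f) x.
Proof.
move=> oD [df cf] Dx.
have d2 w : differentiable ('D_w f) x.
  have dg : differentiable (grad f) x.
    apply/differentiable_mxP => i j.
    under [X in differentiable X _]eq_fun do rewrite mxE.
    by have [+ _] := cf i; exact.
  have dc : differentiable (fun=> w : E) x by exact: differentiable_cst.
  have := (differentiable_mxP _ _).1 (differentiable_mulmx dc dg) 0 0.
  apply: near_eq_differentiable.
  by apply: filterS (near_open oD Dx) => y Dy; rewrite (derive_pairing _ (df _ Dy)).
apply: derive_comm; [|exact: d2..].
by apply: filterS (near_open oD Dx) => y; exact: df.
Qed.

(* f dh - h df is the pull-back of the angular form under (f, h) : D -> S^1. *)
Lemma ext_deriv1_angular D (f h : E -> R) (a : E -> 'cV[R]_n) x :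
  open D -> ck 2 D f -> ck 2 D h -> D x -> ck 0 D a ->
  (forall y, D y -> f y ^+ 2 + h y ^+ 2 = 1) ->
  (forall y v, D y -> pairing (a y) v = f y * 'D_v h y - h y * 'D_v f y) ->
  ext_deriv1_coord a x = 0.
Proof.
move=> oD cf ch Dx ca fh1 aE; have da := ck_diff ca Dx.
have df := ck_diff cf Dx; have dh := ck_diff ch Dx.
have d1 (g : E -> R) w : ck 2 D g -> differentiable ('D_w g) x.
  move=> cg; have dc : ck 1 D (fun=> w : E) by exact: ck_cst.
  have cgr : ck 1 D (grad g).
    apply: ck_mx => // i j; have [_ /(_ i) cgi] := cg.
    by apply: (ck_ext oD _ (cgi : ck 1 D _)) => y _; rewrite mxE.
  apply: near_eq_differentiable (ck_diff (ck_entry 0 0 oD (ck_mulmx oD dc cgr)) Dx).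
  by apply: filterS (near_open oD Dx) => y Dy; rewrite (derive_pairing _ (ck_diff cg Dy)).
have der (g : E -> R) v : differentiable g x -> derivable g x v.
  exact: diff_derivable.
have Da u v : pairing ('D_u a x) v =
    (f x * 'D_u ('D_v h) x + 'D_v h x * 'D_u f x) -
    (h x * 'D_u ('D_v f) x + 'D_v f x * 'D_u h x).
  have dc : differentiable (fun=> v : E) x by exact: differentiable_cst.
  transitivity ('D_u (fun y => pairing (a y) v) x).
    rewrite -(derive_mxE _ _ _ (differentiable_mulmx dc da)).
    by rewrite (derive_mulmx _ dc da) derive_cst mul0mx add0r.
  have dfD : derivable (f * 'D_v h) x u.
    by apply: der; apply: differentiableM => //; exact: d1.
  have dhD : derivable (h * 'D_v f) x u.
    by apply: der; apply: differentiableM => //; exact: d1.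
  transitivity ('D_u (f * 'D_v h - h * 'D_v f) x).
    apply: near_eq_derive; apply: filterS (near_open oD Dx) => y Dy; exact: aE.
  rewrite (deriveB dfD dhD).
  rewrite (deriveM (der _ _ df) (der _ _ (d1 _ _ ch))).
  by rewrite (deriveM (der _ _ dh) (der _ _ (d1 _ _ cf))).
have fh0 u : f x * 'D_u f x + h x * 'D_u h x = 0.
  have dff : derivable (f * f) x u by apply: der; exact: differentiableM.
  have dhh : derivable (h * h) x u by apply: der; exact: differentiableM.
  have : 'D_u (f * f + h * h) x = 0.
    transitivity ('D_u (cst (1 : R)) x); last exact: derive_cst.
    apply: near_eq_derive; apply: filterS (near_open oD Dx) => y Dy.
    by rewrite /cst -(fh1 _ Dy) !expr2.
  rewrite (deriveD dff dhh).
  rewrite (deriveM (der _ _ df) (der _ _ df)) (deriveM (der _ _ dh) (der _ _ dh)).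
  move: (f x) (h x) ('D_u f x) ('D_u h x) => p q r s; rewrite /GRing.scale/=.
  by move=> pq; apply: (@mulIf _ 2); rewrite ?pnatr_eq0// mul0r -pq; ring.
apply: eval2_eqP => u v; rewrite (ext_deriv1_coordE _ _ da) !Da.
have -> : 'D_v ('D_u h) x = 'D_u ('D_v h) x.
  exact: derive_scalar_comm oD (ckS ch) Dx.
have -> : 'D_v ('D_u f) x = 'D_u ('D_v f) x.
  exact: derive_scalar_comm oD (ckS cf) Dx.
have := fh0 u; have := fh0 v; have := fh1 _ Dx.
have -> : eval2 (0 : 'M[R]_n) u v = 0.
  by rewrite -[X in eval2 X](scale0r (0 : 'M[R]_n)) eval2Zm mul0r.
(* The left side of the conclusion is 2 df /\ dh. It vanishes because f df + h dh = 0 makes df and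
   dh proportional; multiplying by f^2 + h^2 = 1 exhibits it as a combination of the two
   relations. *)
have alg (p q r s t w y z : R) : p ^+ 2 + q ^+ 2 = 1 -> p * r + q * s = 0 ->
    p * t + q * w = 0 ->
    (p * y + s * t - (q * z + r * w)) - (p * y + w * r - (q * z + t * s)) = 0.
  move=> pq e1 e2; rewrite -[LHS]mul1r -pq.
  transitivity (2 * ((p * s - q * r) * (p * t + q * w)
    - (p * w - q * t) * (p * r + q * s))); first by ring.
  by rewrite e1 e2 !mulr0 subr0 mulr0.
exact: alg.
Qed.

Lemma near_eq_ext_deriv2_coord (B B' : E -> 'M[R]_n) x u v w :
  (\near x, B x = B' x) ->
  ext_deriv2_coord B x u v w = ext_deriv2_coord B' x u v w.
Proof.
move=> BB'; have D s t r : 'D_s (fun y => eval2 (B y) t r) x =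
    'D_s (fun y => eval2 (B' y) t r) x.
  by apply: near_eq_derive; apply: filterS BB' => y ->.
exact: (congr2 +%R (congr2 +%R (D u v w) (D v w u)) (D w u v)).
Qed.

End ExteriorDerivative.

(** * Change of charts *)

Section Charts.
Context {R : realType} {n : nat} {M : smoothManifold R n}.
Implicit Types (i j k : atlas M) (p q : M) (U : set M).

(** Inside the open image of the chart, this set is the preimage of [dom i] and [U] under the
    continuous inverse chart. *)
Lemma open_chart_image i U : open U -> open (coord i @` (dom i `&` U)).
Proof.
move=> oU; rewrite openE => _ [q [iq Uq] <-].
have im : (coord i @` dom i) (coord i q) by exists q.
have qK : icoord i (coord i q) = q by exact: coordK.
have nU : \forall y \near coord i q, (dom i `&` U) (icoord i y).
  have := icoord_continuous im; apply; rewrite qK.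
  by apply: open_nbhs_nbhs; split=> //; apply: openI => //; exact: dom_open.
have near_im : \forall y \near coord i q, (coord i @` (dom i `&` U)) y.
  have nim := near_open (@image_open _ _ M i) im.
  apply: filterS (filterI nim nU) => _ [[q' iq' <-]].
  by rewrite coordK// => Uq'; exists q'.
exact: near_im.
Qed.

Definition trans i j := coord j \o @icoord _ _ M i.

Lemma trans_coord i j q : dom i q -> trans i j (coord i q) = coord j q.
Proof. by move=> iq; rewrite /trans/= coordK. Qed.

Lemma ck_trans m i j U :
  open U -> ck m (coord i @` (dom i `&` (dom j `&` U))) (trans i j).
Proof.
move=> oU; have := (smooth_on_ck _ _).1 (@transition_smooth _ _ M i j) m.
by apply: ck_sub => _ [q [iq [jq _]] <-]; exists q.
Qed.

Lemma differentiable_trans i j q : dom i q -> dom j q ->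
  differentiable (trans i j) (coord i q).
Proof.
move=> iq jq; apply: ck_diff (ck_trans 0 i j openT) _.
by exists q.
Qed.

(* Locked, since comparing two Jacobians up to conversion is very slow. *)
Definition jac : atlas M -> atlas M -> M -> 'M[R]_n :=
  locked (fun i j q => 'J (trans i j) (coord i q)).

Lemma jacE i j q : jac i j q = 'J (trans i j) (coord i q).
Proof. by rewrite /jac; unlock. Qed.

Lemma derive_trans i j q v : dom i q -> dom j q ->
  'D_v (trans i j) (coord i q) = v *m jac i j q.
Proof. by move=> iq jq; rewrite jacE; exact/derive_jacobian/differentiable_trans. Qed.

Lemma derive_comp_trans (W : normedModType R) i j q (f : 'rV[R]_n -> W) v :
  dom i q -> dom j q -> differentiable f (coord j q) ->
  'D_v (f \o trans i j) (coord i q) = 'D_(v *m jac i j q) f (coord j q).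
Proof.
move=> iq jq df; have dij := differentiable_trans iq jq.
have := derive_chain v dij; move/(_ _ f); rewrite (trans_coord j iq) => /(_ df) ->.
by congr (derive f _ _); exact: derive_trans.
Qed.

(** The chain rule; [trans j k \o trans i j] agrees with [trans i k] only near the point, which
    suffices for the derivative. *)
Lemma jac_mul i j k q : dom i q -> dom j q -> dom k q ->
  jac i j q *m jac j k q = jac i k q.
Proof.
move=> iq jq kq.
have oD : open (coord i @` (dom i `&` dom j)).
  exact/open_chart_image/dom_open.
apply/row_matrixP => l; rewrite !rowE mulmxA; move: (delta_mx 0 l) => v.
apply: etrans (derive_trans v iq kq).
apply: etrans (esym (derive_trans _ jq kq)) _.
apply: etrans (esym (derive_comp_trans v iq jq (differentiable_trans jq kq))) _.
apply: near_eq_derive; apply: filterS (near_open oD _); last by exists q.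
by move=> _ [q' [iq' jq'] <-]; rewrite /= (trans_coord j iq') !trans_coord.
Qed.

Lemma jac_id i q : dom i q -> jac i i q = 1%:M.
Proof.
move=> iq; apply/row_matrixP => l; rewrite !rowE mulmx1.
move: (delta_mx 0 l) => v.
apply: etrans (esym (derive_trans v iq iq)) _.
apply: etrans (derive_id (coord i q) v).
apply: near_eq_derive.
apply: filterS (near_open (@image_open _ _ M i) _); last by exists q.
by move=> _ [q' iq' <-]; rewrite trans_coord.
Qed.

Lemma jac_unit i j q : dom i q -> dom j q -> jac i j q \in unitmx.
Proof.
move=> iq jq; have JJ : jac i j q *m jac j i q = 1%:M by rewrite jac_mul// jac_id.
by have [u _] := mulmx1_unit JJ; exact: u.
Qed.

(** * Components of tensor fields in an arbitrary chart *)

Local Notation c q := (chart_at q).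
Local Notation dc q := (@mem_chart_at _ _ M q).

Lemma to_chartE i q v : dom i q -> to_chart i q v = v *m jac (c q) i q.
Proof. by move=> iq; exact: (derive_trans v (dc q) iq). Qed.

Lemma of_chartE i q v : dom i q -> of_chart i q v = v *m jac i (c q) q.
Proof. by move=> iq; exact: (derive_trans v iq (dc q)). Qed.

Lemma vector_repE i X q : dom i q ->
  vector_rep i X (coord i q) = X q *m jac (c q) i q.
Proof. by move=> iq; rewrite /vector_rep coordK// to_chartE. Qed.

Lemma oneform_repE i w q : dom i q ->
  oneform_rep i w (coord i q) = jac i (c q) q *m w q.
Proof.
move=> iq; apply/colP => j; rewrite mxE coordK// of_chartE//.
by rewrite -pairing_mulmx pairing_basis.
Qed.

Lemma oneform_rep_pairing i (w : M -> 'cV[R]_n) q v : dom i q ->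
  pairing (oneform_rep i w (coord i q)) v = pairing (w q) (of_chart i q v).
Proof.
by move=> iq; rewrite (oneform_repE w iq) pairing_mulmx (of_chartE v iq).
Qed.

Lemma twoform_repE i B q : dom i q ->
  twoform_rep i B (coord i q) = jac i (c q) q *m B q *m (jac i (c q) q)^T.
Proof.
move=> iq; apply/matrixP => j k; rewrite mxE coordK// !of_chartE//.
by rewrite -eval2_mulml -eval2_mulmr eval2_basis.
Qed.

Lemma vector_rep_at X q : vector_rep (c q) X (coord (c q) q) = X q.
Proof. by rewrite (vector_repE X (dc q)) (jac_id (dc q)) mulmx1. Qed.

Lemma twoform_rep_at B q : twoform_rep (c q) B (coord (c q) q) = B q.
Proof.
by rewrite (twoform_repE B (dc q)) (jac_id (dc q)) mul1mx trmx1 mulmx1.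
Qed.

Lemma vector_rep_add i (X X' : M -> 'rV[R]_n) q : dom i q ->
  vector_rep i (fun q => X q + X' q) (coord i q) =
  vector_rep i X (coord i q) + vector_rep i X' (coord i q).
Proof. by move=> iq; rewrite !(vector_repE _ iq) mulmxDl. Qed.

Lemma vector_rep_scale i (f : M -> R) (X : M -> 'rV[R]_n) q : dom i q ->
  vector_rep i (fun q => f q *: X q) (coord i q) =
  f q *: vector_rep i X (coord i q).
Proof. by move=> iq; rewrite !(vector_repE _ iq) -scalemxAl. Qed.

Lemma vector_rep_change i j X q : dom i q -> dom j q ->
  vector_rep j X (coord j q) = vector_rep i X (coord i q) *m jac i j q.
Proof.
move=> iq jq; rewrite (vector_repE X iq) (vector_repE X jq) -mulmxA.
by rewrite (jac_mul (dc q) iq jq).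
Qed.

Lemma oneform_rep_change i j w q : dom i q -> dom j q ->
  oneform_rep i w (coord i q) = jac i j q *m oneform_rep j w (coord j q).
Proof.
move=> iq jq; rewrite (oneform_repE w iq) (oneform_repE w jq) mulmxA.
by rewrite (jac_mul iq jq (dc q)).
Qed.

Lemma twoform_rep_change i j B q : dom i q -> dom j q ->
  twoform_rep i B (coord i q) =
  jac i j q *m twoform_rep j B (coord j q) *m (jac i j q)^T.
Proof.
move=> iq jq; rewrite (twoform_repE B iq) (twoform_repE B jq).
by rewrite -(jac_mul iq jq (dc q)) trmx_mul !mulmxA.
Qed.

Lemma smooth_vector_ck m U i X :
  smooth_vector U X -> ck m (coord i @` (dom i `&` U)) (vector_rep i X).
Proof. by move=> sX; apply/(smooth_on_ck _ _).1/sX. Qed.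

Lemma smooth_oneform_ck m U i w :
  smooth_oneform U w -> ck m (coord i @` (dom i `&` U)) (oneform_rep i w).
Proof. by move=> sw; apply/(smooth_on_ck _ _).1/sw. Qed.

Lemma smooth_fun_ck m U i f :
  smooth_fun U f -> ck m (coord i @` (dom i `&` U)) (f \o icoord i).
Proof. by move=> sf; apply/(smooth_on_ck _ _).1/sf. Qed.

(** [ext_deriv1] differentiates at each point in the preferred chart of that point. Naturality of d
    turns this into one formula in the fixed chart [i], valid on all of its domain in [U], which can
    be differentiated again. *)
Lemma twoform_rep_ext_deriv1 U i w q : open U -> smooth_oneform U w ->
  dom i q -> U q ->
  twoform_rep i (ext_deriv1 w) (coord i q) =
  ext_deriv1_coord (oneform_rep i w) (coord i q).
Proof.
move=> oU sw iq Uq; rewrite twoform_repE//; apply: esym.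
have oD : open (coord i @` (dom i `&` (dom (c q) `&` U))).
  by apply: open_chart_image; apply: openI => //; exact: dom_open.
rewrite !jacE (ext_deriv1_change (a' := oneform_rep (c q) w) oD (ck_trans 1 _ _ oU)).
- by rewrite (trans_coord (c q) iq).
- by exists q => //; split=> //; split=> //; exact: (dc q).
- rewrite (trans_coord (c q) iq); apply: ck_diff (smooth_oneform_ck 0 _ sw) _.
  by exists q => //; split=> //; exact: (dc q).
- move=> _ [q' [iq' [cq' Uq']] <-].
  by rewrite (trans_coord (c q) iq') -jacE (oneform_rep_change w iq' cq').
Qed.

Lemma ext_deriv1_tr (w : M -> 'cV[R]_n) q : (ext_deriv1 w q)^T = - ext_deriv1 w q.
Proof. by apply/matrixP => i j; rewrite !mxE opprB. Qed.

Lemma dir_deriv_chart U i f q v : open U -> smooth_fun U f -> dom i q -> U q ->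
  dir_deriv f q (of_chart i q v) = 'D_v (f \o icoord i) (coord i q).
Proof.
move=> oU sf iq Uq; rewrite /dir_deriv of_chartE//.
have df : differentiable (f \o icoord (c q)) (coord (c q) q).
  apply: ck_diff (smooth_fun_ck 0 _ sf) _.
  by exists q => //; split=> //; exact: (dc q).
apply: etrans (esym (derive_comp_trans v iq (dc q) df)) _.
have oD : open (coord i @` (dom i `&` dom (c q))).
  exact/open_chart_image/dom_open.
apply: near_eq_derive; apply: filterS (near_open oD _).
  by move=> _ [q' [iq' jq'] <-]; rewrite /= trans_coord// !coordK.
by exists q => //; split=> //; exact: (dc q).
Qed.

End Charts.

(** * Closedness of the connective structure *)

(** After multiplication by [z], real and imaginary parts give x = - r Im z and y = r Re z; then
    |z|^2 = 1 recovers r. This expresses z^-1 dz as the angular form. *)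
Lemma dlog_circle {R : realType} (z : R[i]) (r x y : R) : `|z| = 1 ->
  'i%C * r%:C%C = z^-1 * (x%:C%C + 'i%C * y%:C%C) ->
  complex.Re z ^+ 2 + complex.Im z ^+ 2 = 1 /\
  r = complex.Re z * y - complex.Im z * x.
Proof.
move=> z1 e; have z0 : z != 0 by rewrite -normr_eq0 z1 oner_neq0.
have {}e : z * ('i%C * r%:C%C) = x%:C%C + 'i%C * y%:C%C by rewrite e mulVKf.
have zz : complex.Re z ^+ 2 + complex.Im z ^+ 2 = 1.
  move: z1; rewrite normc_def => -[/(congr1 (fun t => t ^+ 2))].
  by rewrite sqr_sqrtr ?expr1n// addr_ge0// sqr_ge0.
split=> //; case: z e zz {z1 z0} => s t /= /eqP.
rewrite eq_complex /= => /andP[/eqP e1 /eqP e2] zz.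
have e1' : - (t * r) = x by apply: etrans (etrans _ e1) _; ring.
have e2' : s * r = y by apply: etrans (etrans _ e2) _; ring.
by rewrite -e1' -e2' -[LHS]mul1r -zz; ring.
Qed.

Section GerbeForms.
Context {R : realType} {n : nat} {M : smoothManifold R n} {G : gerbe M}.
Context (A : connectiveStructure G).
Implicit Types (a b d : gindex G) (q : M) (i : atlas M).

(** The sum of the three connection forms is the logarithmic derivative of the circle-valued
    cocycle, that is, the pull-back of the closed angular form. *)
Lemma ext_deriv1_cocycle a b d q : cover a q -> cover b q -> cover d q ->
  ext_deriv1 (A a b) q + ext_deriv1 (A b d) q + ext_deriv1 (A d a) q = 0.
Proof.
move=> aq bq dq; set i := chart_at q; have iq : dom i q := @mem_chart_at _ _ M q.
set U := cover a `&` cover b `&` cover d.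
have oU : open U by apply: openI; [apply: openI|]; exact: cover_open.
set D := coord i @` (dom i `&` U).
have oD : open D by exact: open_chart_image.
have Dq : D (coord i q) by exists q.
have sA k a' b' : U `<=` cover a' `&` cover b' -> ck k D (oneform_rep i (A a' b')).
  move=> sub; apply: (ck_sub _ (smooth_oneform_ck k i (@conn_smooth _ _ _ _ A a' b'))).
  by move=> _ [q' [iq' /sub Uq'] <-]; exists q'.
have c1 k : ck k D (oneform_rep i (A a b)) by apply: sA => y [[]].
have c2 k : ck k D (oneform_rep i (A b d)) by apply: sA => y [[]].
have c3 k : ck k D (oneform_rep i (A d a)) by apply: sA => y [[]].
have c12 k := ckD oD (c1 k) (c2 k); have c123 k := ckD oD (c12 k) (c3 k).
rewrite -(ext_deriv1_coordD (ck_diff (c1 0) Dq) (ck_diff (c2 0) Dq)).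
rewrite -(ext_deriv1_coordD (ck_diff (c12 0) Dq) (ck_diff (c3 0) Dq)).
have [sRe sIm] := @cocycle_smooth _ _ _ G a b d.
(* [conn_cocycle] speaks of tangent vectors read in the preferred chart of q'; [of_chart] supplies
   the one whose components in the fixed chart [i] are [v]. *)
have sol q' v : dom i q' -> U q' ->
    complex.Re (cocycle a b d q') ^+ 2 + complex.Im (cocycle a b d q') ^+ 2 = 1 /\
    pairing (A a b q' + A b d q' + A d a q') (of_chart i q' v) =
    complex.Re (cocycle a b d q') *
      'D_v ((fun q => complex.Im (cocycle a b d q)) \o icoord i) (coord i q')
    - complex.Im (cocycle a b d q') *
      'D_v ((fun q => complex.Re (cocycle a b d q)) \o icoord i) (coord i q').
  move=> iq' Uq'; have [[aq' bq'] dq'] := Uq'.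
  rewrite -(dir_deriv_chart v oU sRe iq' Uq') -(dir_deriv_chart v oU sIm iq' Uq').
  apply: dlog_circle; first exact: cocycle_circle.
  exact: conn_cocycle.
apply: (ext_deriv1_angular oD (smooth_fun_ck 2 i sRe) (smooth_fun_ck 2 i sIm) Dq).
- exact: c123.
- move=> _ [q' [iq' Uq'] <-]; rewrite /= coordK//.
  by have [] := sol q' 0 iq' Uq'.
- move=> _ v [q' [iq' Uq'] <-]; rewrite !pairingDl !oneform_rep_pairing//.
  have [_] := sol q' v iq' Uq'; rewrite !pairingDl => ->.
  by rewrite /= coordK.
Qed.

(** The cocycle relation for three equal indices says that three times this form vanishes. *)
Lemma ext_deriv1_self a q : cover a q -> ext_deriv1 (A a a) q = 0.
Proof.
move=> aq; have := ext_deriv1_cocycle aq aq aq.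
move=> e; apply/matrixP => i j; have /matrixP/(_ i j) := e; rewrite !mxE.
by move: (_ - _) => r; lra.
Qed.

Lemma ext_deriv1_shift a b d q : cover a q -> cover b q -> cover d q ->
  ext_deriv1 (A a d) q = ext_deriv1 (A a b) q + ext_deriv1 (A b d) q.
Proof.
move=> aq bq dq; have := ext_deriv1_cocycle aq dq aq.
rewrite ext_deriv1_self// addr0 => /eqP; rewrite addr_eq0 => /eqP ->.
by apply/esym/eqP; rewrite -addr_eq0 ext_deriv1_cocycle.
Qed.

End GerbeForms.

(** * Generalized metrics as graphs *)

Section PositiveDefinite.
Context {R : realType} {n : nat}.

Lemma posdef_unitmx (S : 'M[R]_n) :
  (forall v, v != 0 -> 0 < eval2 S v v) -> S \in unitmx.
Proof.
move=> Spos; rewrite -row_free_unit; apply: inj_row_free => v vS.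
apply: contraTeq isT => /Spos.
rewrite -[S]mulmx1 eval2_mulml vS -[X in eval2 _ X](scale0r (0 : 'rV[R]_n)).
by rewrite eval2Zl mul0r ltxx.
Qed.

End PositiveDefinite.

Lemma inner_diag {R : realType} {n : nat} (e : gtFiber R n) :
  inner e e = pairing e.2 e.1.
Proof.
by rewrite /inner -mulr2n -[X in _ * X]mulr_natl mulrA mulVf ?mul1r// pnatr_eq0.
Qed.

Section GeneralizedMetric.
Context {R : realType} {n : nat} {M : smoothManifold R n} {G : gerbe M}.
Context (A : connectiveStructure G).
Context (V : M -> {vspace gtFiber R n}).
Context (hV : generalized_metric A V).
Implicit Types (a b : gindex G) (q : M) (i : atlas M) (v : 'rV[R]_n).

(** The cotangent space is isotropic, so positivity on V leaves only 0 in the intersection. *)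
Lemma metric_fst_inj q e : e \in V q -> e.1 = 0 -> e = 0.
Proof.
case: hV => _ _ pos Ve e1; apply: contraTeq isT => /(pos _ _ Ve).
by rewrite inner_diag e1 /pairing mul0mx mxE ltxx.
Qed.

(** The projection to T is injective on V, and both spaces have dimension n. *)
Lemma metric_fst_surj q v : exists e, e \in V q /\ e.1 = v.
Proof.
case: hV => dV _ _.
pose pr : 'Hom(gtFiber R n, 'rV[R]_n) := linfun fst.
have kerV : (V q :&: lker pr = 0)%VS.
  apply/eqP; rewrite -subv0; apply/subvP => e; rewrite memv_cap memv_ker lfunE/=.
  by move=> /andP[Ve /eqP e0]; rewrite memv0 (metric_fst_inj Ve e0).
have := limg_ker_dim pr (V q); rewrite kerV dimv0 add0n dV => dim_im.
have : v \in (pr @: V q)%VS.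
  suff -> : (pr @: V q)%VS = fullv by exact: memvf.
  by apply/eqP; rewrite eqEdim subvf dim_im dimvf dim_matrix mul1r leqnn.
by move=> /memv_imgP[e Ve ->]; exists e; rewrite lfunE.
Qed.

(** Existence of a lift excludes the default value 0 of [xget]. *)
Lemma lift_plusP q v : lift_plus V q v \in V q /\ (lift_plus V q v).1 = v.
Proof.
have [e Pe] := metric_fst_surj q v.
exact: (xgetPex 0 (ex_intro (fun e => e \in V q /\ e.1 = v) e Pe)).
Qed.

Lemma lift_plus_unique q e : e \in V q -> lift_plus V q e.1 = e.
Proof.
move=> Ve; have [Vl l1] := lift_plusP q e.1.
apply/eqP; rewrite -subr_eq0; apply/eqP; apply: (@metric_fst_inj q).
  exact: memvB.
by rewrite /= l1 subrr.
Qed.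

(* V q is the graph of v |-> i_v C, and its orthogonal complement the graph   *)
(* of v |-> - i_v C^T.                                                        *)
Definition graph_mx q : 'M[R]_n :=
  \matrix_(j, k) (lift_plus V q (basis_vec j)).2 k 0.

(** A linear combination of lifts lies in V over the right vector, so uniqueness makes the lift
    linear and determined by its values on the basis. *)
Lemma lift_plusE q v : lift_plus V q v = (v, contract2 v (graph_mx q)).
Proof.
pose L v := lift_plus V q v.
have lL : linear L.
  move=> k u w; rewrite /L; have [Vu u1] := lift_plusP q u.
  have [Vw w1] := lift_plusP q w.
  rewrite -{1}u1 -{1}w1.
  have -> : k *: (lift_plus V q u).1 + (lift_plus V q w).1 =
    (k *: lift_plus V q u + lift_plus V q w).1 by [].
  by apply: lift_plus_unique; rewrite memvD// memvZ.
pose L' : {linear 'rV[R]_n -> gtFiber R n} :=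
  HB.pack L (GRing.isLinear.Build _ _ _ _ L lL).
have [_ e1] := lift_plusP q v.
rewrite [LHS]surjective_pairing e1; congr pair.
rewrite -[lift_plus V q v]/(L' v) {1}[v]row_sum_delta linear_sum.
rewrite (linear_sum snd); apply/colP => k.
rewrite summxE /contract2 mxE mxE; apply: eq_bigr => j _.
by rewrite [L' _]linearZ /= !mxE.
Qed.

Lemma mem_metricE q e : (e \in V q) = (e.2 == contract2 e.1 (graph_mx q)).
Proof.
apply/idP/eqP => [Ve|e2]; first by rewrite -[in LHS](lift_plus_unique Ve) lift_plusE.
by rewrite [e]surjective_pairing e2 -lift_plusE; have [] := lift_plusP q e.1.
Qed.

Lemma graph_mx_pos q v : v != 0 -> 0 < eval2 (graph_mx q) v v.
Proof.
case: hV => _ _ pos v0; have [Ve _] := lift_plusP q v.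
have := pos _ _ Ve; rewrite inner_diag lift_plusE/= pairing_contract2; apply.
by apply: contraNneq v0 => /(congr1 fst) /= ->.
Qed.

(** The element on the right is orthogonal to every u^+ because C(u, v) - C^T(v, u) = 0. Conversely,
    orthogonality to all u^+ prescribes the pairing of the cotangent part with every u, which gives
    uniqueness. *)
Lemma lift_minusE q v : lift_minus V q v = (v, - contract2 v (graph_mx q)^T).
Proof.
set e : gtFiber R n := (v, _).
have orth f : f \in V q -> inner e f = 0.
  rewrite mem_metricE => /eqP f2; rewrite /inner f2 /e /= pairingNl.
  by rewrite !pairing_contract2 eval2_tr subrr mulr0.
have [lorth l1] := xgetPex 0 (ex_intro
  (fun e => (forall f, f \in V q -> inner e f = 0) /\ e.1 = v) e (conj orth erefl)).
rewrite -/(lift_minus V q v) in lorth l1 *.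
rewrite [LHS]surjective_pairing l1 /e; congr pair.
apply: pairing_eqP => u; have [Vu u1] := lift_plusP q u.
have := lorth _ Vu; rewrite -(orth _ Vu) /inner l1 /= u1.
by move=> /(mulfI (invr_neq0 _)); rewrite pnatr_eq0 => /(_ isT) /addrI.
Qed.

Lemma metric_mapE q v :
  metric_map V q v = contract2 v (2^-1 *: (graph_mx q + (graph_mx q)^T)).
Proof.
rewrite /metric_map lift_plusE lift_minusE /= opprK /contract2.
by rewrite -scalemxAr [RHS]linearZ /= mulmxDr [(_ + _)^T]linearD.
Qed.

Lemma metricE q u v :
  metric V q u v = 2^-1 * eval2 (graph_mx q + (graph_mx q)^T) u v.
Proof. by rewrite /metric metric_mapE pairing_contract2 eval2Zm. Qed.

(* The matrix whose graph is V q in the trivialization of E over cover a. *)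
Definition graph_triv a q : 'M[R]_n :=
  graph_mx q + ext_deriv1 (A (index_at G q) a) q.

Lemma gt_triv_plus a q v :
  gt_triv A a q (lift_plus V q v) = (v, (v *m graph_triv a q)^T).
Proof. by rewrite /gt_triv lift_plusE /contract2 /= mulmxDr linearD. Qed.

Lemma gt_triv_minus a q v :
  gt_triv A a q (lift_minus V q v) = (v, - (graph_triv a q *m v^T)).
Proof.
rewrite /gt_triv lift_minusE /contract2 /= !trmx_mul !trmxK /graph_triv.
by rewrite ext_deriv1_tr mulNmx -opprD mulmxDl.
Qed.

Lemma graph_triv_sym a q :
  graph_triv a q + (graph_triv a q)^T = graph_mx q + (graph_mx q)^T.
Proof. by rewrite /graph_triv linearD/= ext_deriv1_tr addrACA subrr addr0. Qed.

(** The average of C and - C^T is the antisymmetric part of C; dA is itself antisymmetric, so adding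
    it to the average is the same as adding it to C. *)
Lemma curvingE a q :
  curving A V a q = 2^-1 *: (graph_triv a q - (graph_triv a q)^T).
Proof.
apply/matrixP => j k; rewrite /curving mxE lift_plusE lift_minusE /gt_triv /=.
set F := ext_deriv1 _ _; rewrite /graph_triv -/F.
have -> : basis_vec j + basis_vec j = 2 *: basis_vec j :> 'rV[R]_n.
  by rewrite scaler_nat mulr2n.
rewrite scalerA mulVf ?pnatr_eq0// scale1r /contract2 /basis_vec -!rowE.
have FT : F k j = - F j k.
  by have /matrixP/(_ j k) := ext_deriv1_tr (A (index_at G q) a) q; rewrite !mxE.
move: F FT => F FT; rewrite !mxE FT.
have alg (x y z : R) : 2^-1 * (x - y) + z = 2^-1 * (x + z - (y - z)) by field.
exact: alg.
Qed.

Lemma graph_triv_change a b q : cover a q -> cover b q ->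
  graph_triv b q = graph_triv a q + ext_deriv1 (A a b) q.
Proof.
move=> aq bq; rewrite /graph_triv -addrA; congr (_ + _).
exact: ext_deriv1_shift (@mem_index_at _ _ _ G q) aq bq.
Qed.

Lemma graph_triv_index q : graph_triv (index_at G q) q = graph_mx q.
Proof. by rewrite /graph_triv ext_deriv1_self ?addr0//; exact: mem_index_at. Qed.

Definition graph_rep i a := twoform_rep i (graph_triv a).

Lemma oneform_rep_plus i a (Y : M -> 'rV[R]_n) q : dom i q ->
  oneform_rep i (fun q => (gt_triv A a q (lift_plus V q (Y q))).2) (coord i q) =
  (vector_rep i Y (coord i q) *m graph_rep i a (coord i q))^T.
Proof.
move=> iq; have cq := @mem_chart_at _ _ M q.
rewrite (oneform_repE _ iq) gt_triv_plus (vector_repE _ iq).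
rewrite /graph_rep (twoform_repE _ iq) /= !mulmxA -(mulmxA (Y q)).
by rewrite (jac_mul cq iq cq) (jac_id cq) mulmx1 [RHS]trmx_mul trmxK.
Qed.

Lemma oneform_rep_minus i a (X : M -> 'rV[R]_n) q : dom i q ->
  oneform_rep i (fun q => (gt_triv A a q (lift_minus V q (X q))).2) (coord i q) =
  - (graph_rep i a (coord i q) *m (vector_rep i X (coord i q))^T).
Proof.
move=> iq; have cq := @mem_chart_at _ _ M q.
rewrite (oneform_repE _ iq) gt_triv_minus (vector_repE _ iq).
rewrite /graph_rep (twoform_repE _ iq) /= mulmxN; congr (- _).
rewrite -!mulmxA; congr (_ *m (_ *m _)).
by rewrite -trmx_mul -mulmxA (jac_mul cq iq cq) (jac_id cq) mulmx1.
Qed.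

(** For a local frame of V, the rows of [S1] and [S2] are the tangent and cotangent components of
    its members. The graph relation reads S1 C = S2, so C = S1^-1 S2 is as smooth as the frame. *)
Lemma ck_graph_rep m i a :
  ck m (coord i @` (dom i `&` cover a)) (graph_rep i a).
Proof.
apply: ck_local => _ [p [ip ap] <-].
case: hV => _ /(_ p)[W [s [oW Wp ss Vs]]] _.
set D := coord i @` (dom i `&` (W `&` cover a)); exists D; first by exists p.
have oD : open D.
  by apply: open_chart_image; apply: openI => //; exact: cover_open.
have sV k q : W q -> s k q \in V q.
  move=> Wq; rewrite (Vs _ Wq).
  by apply: memv_span; apply/mapP; exists k; rewrite ?mem_enum.
pose S1 x := \matrix_(k, j) vector_rep i (fun q => (s k q).1) x 0 j.
pose S2 x := \matrix_(k, j) oneform_rep i (fun q => (gt_triv A a q (s k q)).2) x j 0.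
have cS1 : ck m D S1.
  apply: ck_mx => // k j; have [sv _] := ss k.
  have c1 : ck m D (vector_rep i (fun q => (s k q).1)).
    apply: ck_sub (smooth_vector_ck m i sv).
    by move=> _ [q [iq [Wq _]] <-]; exists q.
  by apply: ck_ext (ck_entry 0 j oD c1) => // x _; rewrite mxE.
have cS2 : ck m D S2.
  apply: ck_mx => // k j; have [_ sw] := ss k.
  apply: ck_ext (ck_entry j 0 oD (smooth_oneform_ck m i (sw a))) => // x _.
  by rewrite [RHS]mxE.
have S1E q : dom i q ->
    S1 (coord i q) = (\matrix_k (s k q).1) *m jac (chart_at q) i q.
  move=> iq; apply/row_matrixP => k; rewrite row_mul !rowK.
  exact: (vector_repE (fun q => (s k q).1) iq).
have S1u x : D x -> S1 x \in unitmx.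
  move=> [q [iq [Wq aq]] <-]; rewrite (S1E _ iq) unitmx_mul.
  rewrite (jac_unit (@mem_chart_at _ _ M q) iq) andbT.
  (* The lift of each basis vector lies in the span of the frame; its tangent component is then a
     combination of the rows, which yields a left inverse. *)
  suff /fin_all_exists[f fE] : forall j, exists c : 'rV[R]_n,
      basis_vec j = c *m \matrix_k (s k q).1.
    have SS : (\matrix_j f j) *m (\matrix_k (s k q).1) = 1%:M.
      by apply/row_matrixP => j; rewrite row_mul rowK -fE rowE mulmx1.
    by have [_ u] := mulmx1_unit SS; exact: u.
  move=> j; have [Ve e1] := lift_plusP q (basis_vec j); rewrite -e1.
  move: Ve; rewrite (Vs _ Wq) span_def big_image/= => /memv_sumP[vs vsP ->].
  have /fin_all_exists[c cE] : forall k, exists c : R, vs k = c *: s k q.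
    by move=> k; apply/vlineP/vsP.
  exists (\row_k c k); rewrite (linear_sum fst) mulmx_sum_row.
  by apply: eq_bigr => k _; rewrite cE rowK mxE.
apply: ck_ext (ck_mulmx oD (ck_invmx oD S1u cS1) cS2) => // x Dx.
rewrite -[RHS](mulKmx (S1u _ Dx)); congr (_ *m _).
case: Dx => q [iq [Wq aq]] <-; apply/row_matrixP => k.
rewrite row_mul; apply: trmx_inj.
have -> : row k (S1 (coord i q)) = vector_rep i (fun q => (s k q).1) (coord i q).
  by apply/rowP => j; rewrite !mxE.
rewrite -oneform_rep_plus//; apply/colP => j.
transitivity (oneform_rep i (fun q => (gt_triv A a q (s k q)).2) (coord i q) j 0).
  by rewrite 3![LHS]mxE.
by rewrite !(oneform_repE _ iq) /= (lift_plus_unique (sV k q Wq)).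
Qed.

End GeneralizedMetric.

(** * The connection *)

Section BismutConnection.
Context {R : realType} {n : nat} {M : smoothManifold R n} {G : gerbe M}.
Context (A : connectiveStructure G).
Context (V : M -> {vspace gtFiber R n}).
Context (hV : generalized_metric A V).
Implicit Types (a b : gindex G) (p q : M) (i : atlas M) (v w : 'rV[R]_n).
Implicit Types X Y Z : M -> 'rV[R]_n.

Local Notation C := (graph_rep A V).
Local Notation vfield X := (smooth_vector setT X).

Lemma graph_rep_sym i a q : dom i q ->
  C i a (coord i q) + (C i a (coord i q))^T =
  jac i (chart_at q) q *m (graph_mx V q + (graph_mx V q)^T)
    *m (jac i (chart_at q) q)^T.
Proof.
move=> iq; rewrite /graph_rep (twoform_repE _ iq) -(graph_triv_sym A V a q).
by rewrite !trmx_mul trmxK mulmxA -mulmxDl -mulmxDr.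
Qed.

Lemma graph_mx_sym_unit q : graph_mx V q + (graph_mx V q)^T \in unitmx.
Proof.
apply: posdef_unitmx => v v0; rewrite eval2Dm eval2_tr.
by have := graph_mx_pos hV q v0 => e; rewrite addr_gt0.
Qed.

Lemma graph_rep_sym_unit i a q : dom i q ->
  C i a (coord i q) + (C i a (coord i q))^T \in unitmx.
Proof.
move=> iq; rewrite graph_rep_sym// !unitmx_mul unitmx_tr graph_mx_sym_unit.
by rewrite !(jac_unit iq (@mem_chart_at _ _ M q)).
Qed.

Lemma graph_rep_at q : C (chart_at q) (index_at G q) (coord (chart_at q) q) =
  graph_mx V q.
Proof. by rewrite /graph_rep twoform_rep_at graph_triv_index. Qed.

Lemma near_chart (P : 'rV[R]_n -> Prop) i a q : dom i q -> cover a q ->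
  (forall q, dom i q -> cover a q -> P (coord i q)) ->
  \forall x \near coord i q, P x.
Proof.
move=> iq aq Pi.
have oD : open (coord i @` (dom i `&` cover a)).
  exact/open_chart_image/cover_open.
have Dq : (coord i @` (dom i `&` cover a)) (coord i q) by exists q.
by apply: filterS (near_open oD Dq) => _ [q' [iq' aq'] <-]; exact: Pi.
Qed.

Lemma ck_vfield m i U X : vfield X ->
  ck m (coord i @` (dom i `&` U)) (vector_rep i X).
Proof.
move=> sX; apply: ck_sub (smooth_vector_ck m i sX).
by move=> _ [q [iq _] <-]; exists q.
Qed.

Lemma differentiable_vfield i X q : vfield X -> dom i q ->
  differentiable (vector_rep i X) (coord i q).
Proof. by move=> sX iq; apply: ck_diff (ck_vfield 0 i setT sX) _; exists q. Qed.

Lemma differentiable_graph_rep i a q : dom i q -> cover a q ->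
  differentiable (C i a) (coord i q).
Proof. by move=> iq aq; apply: ck_diff (ck_graph_rep hV 0 i a) _; exists q. Qed.

(** Chart and index are those preferred at q; [bismut_rep] shows that any others give the same
    vector. Metric connections whose torsion is a three-form are known as Bismut connections. *)
Definition bismut X Y q : 'rV[R]_n :=
  koszul_connection (C (chart_at q) (index_at G q)) (X q)
    (vector_rep (chart_at q) Y) (coord (chart_at q) q).

(** Near the point, C over [a] is C over [b] plus d(A b a), a shift by an exact two-form. *)
Lemma koszul_connection_change_index i a b q u
    (Y : 'rV[R]_n -> 'rV[R]_n) : dom i q ->
  cover a q -> cover b q ->
  koszul_connection (C i a) u Y (coord i q) =
  koszul_connection (C i b) u Y (coord i q).
Proof.
move=> iq aq bq; apply: koszul_connection_congr => [|w].
  exact: etrans (graph_rep_sym a iq) (esym (graph_rep_sym b iq)).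
set U := cover a `&` cover b.
have oU : open U by apply: openI; exact: cover_open.
have oD : open (coord i @` (dom i `&` U)) by exact: open_chart_image.
have Dq : (coord i @` (dom i `&` U)) (coord i q) by exists q.
have sA := @conn_smooth _ _ _ _ A b a.
have cA : ck 2 (coord i @` (dom i `&` U)) (oneform_rep i (A b a)).
  apply: ck_sub (smooth_oneform_ck 2 i sA).
  by move=> _ [q' [iq' [aq' bq']] <-]; exists q'.
apply: etrans (koszul_addl_closed Y u w oD cA Dq (differentiable_graph_rep iq bq)).
apply: near_eq_koszul_form.
apply: filterS (near_open oD Dq) => _ [q' [iq' [aq' bq']] <-].
have oV : open (cover b `&` cover a) by apply: openI; exact: cover_open.
have e := twoform_rep_ext_deriv1 oV sA iq' (conj bq' aq').
apply: etrans (congr1 (fun F => C i b (coord i q') + F) e).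
have e1 := twoform_repE (graph_triv A V a) iq'.
have e2 := twoform_repE (graph_triv A V b) iq'.
have e3 := twoform_repE (ext_deriv1 (A b a)) iq'.
apply: etrans e1 (etrans _ (esym (congr2 +%R e2 e3))).
rewrite (graph_triv_change A V bq' aq').
move: (jac i _ q') (graph_triv A V b q') (ext_deriv1 (A b a) q') => J B F.
by rewrite mulmxDr mulmxDl.
Qed.

Lemma bismut_rep i a X Y q : vfield X -> vfield Y -> dom i q -> cover a q ->
  vector_rep i (bismut X Y) (coord i q) =
  koszul_connection (C i a) (vector_rep i X (coord i q)) (vector_rep i Y) (coord i q).
Proof.
move=> sX sY iq aq; rewrite !(vector_repE _ iq) /bismut.
set c := chart_at q; set b := index_at G q.
have cq : dom c q := @mem_chart_at _ _ M q.
have bq : cover b q := @mem_index_at _ _ _ G q.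
apply: etrans (esym (koszul_connection_change_index _ _ iq aq bq)).
have oU : open (cover b) by exact: cover_open.
have oD : open (coord c @` (dom c `&` (dom i `&` cover b))).
  by apply: open_chart_image; apply: openI => //; exact: dom_open.
have Dq : (coord c @` (dom c `&` (dom i `&` cover b))) (coord c q) by exists q.
have tq : trans c i (coord c q) = coord i q by exact: trans_coord.
have := @koszul_connection_change _ _ _ (trans c i) (C c b) (C i b)
  (vector_rep c Y) (vector_rep i Y) (coord c q) (X q) oD (ck_trans 1 c i oU) Dq.
rewrite tq -jacE; apply.
- exact: differentiable_graph_rep.
- exact: differentiable_graph_rep.
- exact: differentiable_vfield.
- exact: differentiable_vfield.
- move=> _ [q' [cq' [iq' bq']] <-]; rewrite (trans_coord i cq') -jacE.
  exact: twoform_rep_change.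
- move=> _ [q' [cq' [iq' bq']] <-]; rewrite (trans_coord i cq') -jacE.
  exact: vector_rep_change.
- exact: jac_unit.
- exact: graph_rep_sym_unit.
- exact: graph_rep_sym_unit.
Qed.

(** Around each point one index [b] serves for all neighbouring points, and there the components are
    given by the model formula with smooth coefficients. *)
Lemma smooth_bismut X Y : vfield X -> vfield Y -> vfield (bismut X Y).
Proof.
move=> sX sY i; apply/smooth_on_ck => m; apply: ck_local => _ [q [iq _] <-].
set b := index_at G q; have bq : cover b q := @mem_index_at _ _ _ G q.
exists (coord i @` (dom i `&` cover b)); first by exists q.
have oD : open (coord i @` (dom i `&` cover b)).
  exact/open_chart_image/cover_open.
have Su x : (coord i @` (dom i `&` cover b)) x -> C i b x + (C i b x)^T \in unitmx.
  by move=> [q' [iq' _] <-]; exact: graph_rep_sym_unit.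
have := ck_koszul_connection oD (ck_graph_rep hV m.+1 i b)
  (ck_vfield m i (cover b) sX) (ck_vfield m.+1 i (cover b) sY) Su.
apply: ck_ext => // _ [q' [iq' bq'] <-].
by rewrite (bismut_rep sX sY iq' bq').
Qed.

Local Notation c q := (chart_at q).
Local Notation at_center q := (@mem_chart_at _ _ M q).

Lemma eval2_bismut X Y q w :
  eval2 (graph_mx V q + (graph_mx V q)^T) (bismut X Y q) w =
  koszul (C (c q) (index_at G q)) (X q) (vector_rep (c q) Y) (coord (c q) q) w.
Proof.
have bq : cover (index_at G q) q := @mem_index_at _ _ _ G q.
have dC := differentiable_graph_rep (at_center q) bq.
have := eval2_koszul_connection (X q) (vector_rep (c q) Y) w dC.
rewrite graph_rep_at; apply; exact: graph_mx_sym_unit.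
Qed.

Lemma near_dom (P : 'rV[R]_n -> Prop) i q : dom i q ->
  (forall q, dom i q -> P (coord i q)) -> \forall x \near coord i q, P x.
Proof.
move=> iq Pi; apply: (near_chart iq (@mem_index_at _ _ _ G q)) => q' iq' _.
exact: Pi.
Qed.

(** Each pointwise identity is tested against the nondegenerate form C + C^T, where it becomes
    linearity or the Leibniz rule of [koszul] at the centre of the preferred chart. *)
Lemma bismut_is_connection : is_connection bismut.
Proof.
have S_unit := graph_mx_sym_unit.
have dC q := differentiable_graph_rep (at_center q) (@mem_index_at _ _ _ G q).
have dV X q : vfield X -> differentiable (vector_rep (c q) X) (coord (c q) q).
  by move=> sX; exact: differentiable_vfield sX (at_center q).
have dF f q : smooth_fun setT f ->
    differentiable (f \o icoord (c q)) (coord (c q) q).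
  move=> sf; apply: ck_diff (smooth_fun_ck 0 (c q) sf) _.
  by exists q => //; split=> //; exact: (at_center q).
split; first exact: smooth_bismut.
split=> [X X' Y sX sX' sY q|].
  apply: (eval2_nondeg (S_unit q)) => w; rewrite eval2Dl.
  apply: etrans (eval2_bismut _ _ _ _) (etrans _ (esym (congr2 +%R
    (eval2_bismut X Y q w) (eval2_bismut X' Y q w)))).
  exact: koszulD_dir (dC q) (dV Y q sY).
split=> [f X Y sf sX sY q|].
  apply: (eval2_nondeg (S_unit q)) => w; rewrite eval2Zl.
  apply: etrans (eval2_bismut _ _ _ _) (etrans _ (esym (congr1 ( *%R (f q))
    (eval2_bismut X Y q w)))).
  exact: koszulZ_dir (dC q) (dV Y q sY).
split=> [X Y Y' sX sY sY' q|f X Y sf sX sY q].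
  apply: (eval2_nondeg (S_unit q)) => w; rewrite eval2Dl.
  apply: etrans (eval2_bismut _ _ _ _) (etrans _ (esym (congr2 +%R
    (eval2_bismut X Y q w) (eval2_bismut X Y' q w)))).
  apply: etrans (koszulD _ _ (dC q) (dV Y q sY) (dV Y' q sY')).
  apply: near_eq_koszul_field; apply: (near_dom (at_center q)) => q' iq'.
  exact: vector_rep_add.
apply: (eval2_nondeg (S_unit q)) => w; rewrite eval2Dl !eval2Zl.
apply: etrans (eval2_bismut _ _ _ _) (etrans _ (esym (congr1
  (fun t => _ + f q * t) (eval2_bismut X Y q w)))).
have := koszulZ (X q) w (dC q) (dV Y q sY) (dF f q sf).
have fq : (f \o icoord (c q)) (coord (c q) q) = f q.
  by rewrite /= (coordK (at_center q)).
rewrite fq graph_rep_at vector_rep_at /dir_deriv; apply: etrans.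
apply: near_eq_koszul_field; apply: (near_dom (at_center q)) => q' iq'.
by rewrite (vector_rep_scale f Y iq') /= (coordK iq').
Qed.

Lemma metric_rep i a Y Z q : dom i q ->
  metric V q (Y q) (Z q) =
  2^-1 * eval2 (C i a (coord i q) + (C i a (coord i q))^T)
    (vector_rep i Y (coord i q)) (vector_rep i Z (coord i q)).
Proof.
move=> iq; rewrite (metricE hV) (graph_rep_sym a iq) !(vector_repE _ iq).
move: (graph_mx V q + (graph_mx V q)^T) => S.
have e X : X q *m jac (c q) i q *m jac i (c q) q = X q.
  rewrite -mulmxA (jac_mul (at_center q) iq (at_center q)).
  by rewrite (jac_id (at_center q)) mulmx1.
by rewrite eval2_mulmr eval2_mulml !e.
Qed.

Lemma metric_sym q v w : metric V q v w = metric V q w v.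
Proof. by rewrite !(metricE hV) !eval2Dm !eval2_tr addrC. Qed.

Lemma metric_bismut X Y q w : metric V q (bismut X Y q) w = 2^-1 *
  koszul (C (c q) (index_at G q)) (X q) (vector_rep (c q) Y) (coord (c q) q) w.
Proof. by rewrite (metricE hV) (eval2_bismut X Y). Qed.

Lemma bismut_preserves_metric : preserves_metric (metric V) bismut.
Proof.
move=> X Y Z sX sY sZ q; set a := index_at G q.
have aq : cover a q := @mem_index_at _ _ _ G q.
have dC := differentiable_graph_rep (at_center q) aq.
have dY := differentiable_vfield sY (at_center q).
have dZ := differentiable_vfield sZ (at_center q).
have e1 := metric_bismut X Y q (Z q).
have e2 := etrans (metric_sym q (Y q) (bismut X Z q)) (metric_bismut X Z q (Y q)).
apply: etrans (esym (congr2 +%R e1 e2)); apply: etrans (mulrDr _ _ _).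
have := koszul_metric (X q) dC dY dZ; rewrite !vector_rep_at => km.
apply: etrans (congr1 ( *%R 2^-1) km).
pose h y := eval2 (C (c q) a y + (C (c q) a y)^T)
  (vector_rep (c q) Y y) (vector_rep (c q) Z y).
have dh : differentiable h (coord (c q) q).
  have dS := differentiableD dC (differentiable_trmx dC).
  have := differentiable_mulmx (differentiable_mulmx dY dS) (differentiable_trmx dZ).
  by move=> /differentiable_mxP; exact.
have dhZ : 'D_(X q) (2^-1 *: h) (coord (c q) q) = 2^-1 * 'D_(X q) h (coord (c q) q).
  by apply: deriveZ; exact: diff_derivable.
apply: etrans dhZ.
apply: near_eq_derive; apply: (near_dom (at_center q)) => q' iq'.
by rewrite /= (coordK iq') (metric_rep a Y Z iq').
Qed.

Lemma bismut_torsion : has_skew_torsion_opp (metric V) (curvature A V) bismut.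
Proof.
move=> X Y sX sY q w; set a := index_at G q.
have aq : cover a q := @mem_index_at _ _ _ G q.
have dC := differentiable_graph_rep (at_center q) aq.
have dX := differentiable_vfield sX (at_center q).
have dY := differentiable_vfield sY (at_center q).
have -> : curvature A V q (Y q) (X q) w = ext_deriv2_coord
    (fun y => 2^-1 *: (C (c q) a y - (C (c q) a y)^T)) (coord (c q) q)
    (Y q) (X q) w.
  apply: near_eq_ext_deriv2_coord; apply: (near_dom (at_center q)) => q' iq'.
  rewrite /graph_rep !(twoform_repE _ iq') (curvingE hV).
  move: (jac _ _ _) (graph_triv _ _ _ _) => J B.
  by rewrite !trmx_mul trmxK -scalemxAr -scalemxAl mulmxBr mulmxBl !mulmxA.
(* The fields are exchanged because i_X i_Y H = H(Y, X, _); this is where the sign of the torsion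
   comes from. *)
have := koszul_torsion w dC dY dX; rewrite !vector_rep_at graph_rep_at.
have lieN : lie_bracket X Y q = - lie_coord (vector_rep (c q) Y)
    (vector_rep (c q) X) (coord (c q) q) by rewrite opprB.
have eXY := eval2_bismut X Y q w; have eYX := eval2_bismut Y X q w.
rewrite (metricE hV) lieN.
move: (lie_coord _ _ _) (bismut X Y q) (bismut Y X q) eXY eYX => l b1 b2.
move: (koszul _ _ _ _ _) (koszul _ _ _ _ _) (ext_deriv2_coord _ _ _ _ _).
move: (graph_mx V q + (graph_mx V q)^T) => S k2 k1 t.
rewrite !eval2Dl opprK !eval2Nl => -> ->; move: (eval2 S l w) => s; clear.
by move=> tor; lra.
Qed.

(** The term - C [X, Y]^T left in the bracket is the cotangent part of [X, Y]^-, so the difference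
    has only the [koszul] one-form, which is 2 g applied to the connection. *)
Lemma bismut_courant X Y q : vfield X -> vfield Y ->
  gt_courant A (fun q => lift_minus V q (X q)) (fun q => lift_plus V q (Y q)) q
  - lift_minus V q (lie_bracket X Y q) = (0, 2 *: metric_map V q (bismut X Y q)).
Proof.
move=> sX sY; set a := index_at G q.
have aq : cover a q := @mem_index_at _ _ _ G q.
have dC := differentiable_graph_rep (at_center q) aq.
have dX := differentiable_vfield sX (at_center q).
have dY := differentiable_vfield sY (at_center q).
set xi := oneform_rep (c q) (fun q => (gt_triv A a q (lift_minus V q (X q))).2).
set eta := oneform_rep (c q) (fun q => (gt_triv A a q (lift_plus V q (Y q))).2).
have xiE : \forall x \near coord (c q) q,
    xi x = - (C (c q) a x *m (vector_rep (c q) X x)^T).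
  apply: (near_dom (at_center q)) => q' iq'; exact: oneform_rep_minus.
have etaE : \forall x \near coord (c q) q,
    eta x = (vector_rep (c q) Y x *m C (c q) a x)^T.
  apply: (near_dom (at_center q)) => q' iq'; exact: oneform_rep_plus.
have minusE : (fun q => (lift_minus V q (X q)).1) = X.
  by apply/funext => q'; rewrite (lift_minusE hV).
have plusE : (fun q => (lift_plus V q (Y q)).1) = Y.
  by apply/funext => q'; rewrite (lift_plusE hV).
rewrite /gt_courant /= minusE plusE -/xi -/eta.
rewrite (courant_coord_koszul dC dX dY xiE etaE) (lift_minusE hV) (metric_mapE hV).
rewrite -/(lie_bracket X Y q) vector_rep_at graph_rep_at.
have bE := @koszul_connectionK _ _ (C (c q) a) (X q) (vector_rep (c q) Y)
  (coord (c q) q).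
rewrite graph_rep_at in bE; have {}bE := bE (graph_mx_sym_unit q).
rewrite -/(bismut X Y q) in bE; rewrite -bE.
move: (bismut X Y q) (lie_bracket X Y q) (graph_mx V q) => b l B.
congr pair; first by rewrite /= subrr.
rewrite /= /contract2 opprK [(l *m _)^T]trmx_mul trmxK subrK -scalemxAr.
by rewrite [in RHS]linearZ /= scalerA mulfV ?scale1r// pnatr_eq0.
Qed.

End BismutConnection.

Theorem theorem2 (R : realType) (n : nat) (M : smoothManifold R n)
    (G : gerbe M) (A : connectiveStructure G)
    (V : M -> {vspace gtFiber R n}) (hV : generalized_metric A V) :
  exists nabla : (M -> 'rV[R]_n) -> (M -> 'rV[R]_n) -> M -> 'rV[R]_n,
    [/\ is_connection nabla,
        preserves_metric (metric V) nabla,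
        has_skew_torsion_opp (metric V) (curvature A V) nabla &
        forall X Y : M -> 'rV[R]_n,
          smooth_vector setT X -> smooth_vector setT Y ->
          forall p : M,
            gt_courant A (fun q => lift_minus V q (X q))
                         (fun q => lift_plus V q (Y q)) p
            - lift_minus V p (lie_bracket X Y p)
            = (0, 2 *: metric_map V p (nabla X Y p))].
Proof.
exists (bismut A V); split.
- exact: bismut_is_connection.
- exact: bismut_preserves_metric.
- exact: bismut_torsion.
- by move=> X Y sX sY p; exact: bismut_courant.
Qed.
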